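(* Let $\mu>0$ and let $X^{-\mu}=\{X^{-\mu}_t\}_{t\ge0}$ be a Brownian motion with negative drift, $X^{-\mu}_t=-\mu t+\sqrt{2}B_t$ with $B$ a standard Brownian motion (generator $-\mu\frac{d}{dx}+\frac{d^2}{dx^2}$), started at $X^{-\mu}_0=0$. Then $$\max_{0\le s\le t}X^{-\mu}_s\stackrel{d}{=}L_t\wedge T_\mu,\qquad t>0,$$ where $T_\mu$ is an exponential random variable with parameter $\mu$ (i.e. $\mathbf{P}(T_\mu>x)=e^{-\mu x}$) independent of $L$, and $L$ is the inverse of a relativistic stable subordinator with Laplace exponent $\Phi(\lambda)=\sqrt{\lambda+\eta}-\sqrt{\eta}$, $\eta=(\mu/2)^2$.
   Context: For a subordinator $H$ with $H_0=0$ and $\mathbf{E}[e^{-\lambda H_t}]=e^{-t\Phi(\lambda)}$, its inverse is $L_t=\inf\{s>0:H_s>t\}$, $L_0=0$. The relativistic (tempered) stable subordinator of order $1/2$ has Lévy measure $\frac{1}{2\sqrt\pi}e^{-\eta s}s^{-3/2}ds$ and Laplace exponent $\sqrt{\lambda+\eta}-\sqrt\eta$. *)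

(* Defs.v *)
From HB Require Import structures.
From mathcomp Require Import all_boot all_order all_algebra.
From mathcomp Require Import all_classical all_reals all_analysis.
Set Implicit Arguments. Unset Strict Implicit. Unset Printing Implicit Defensive.
Import Order.TTheory GRing.Theory Num.Theory.
Import numFieldNormedType.Exports.
Local Open Scope classical_set_scope.
Local Open Scope ring_scope.

Section defs.
Context {R : realType} {d : measure_display} {Omega : measurableType d}.
Variable P : probability Omega R.

Definition mutually_indep (n : nat) (X : 'I_n -> Omega -> R) : Prop :=
  forall A : 'I_n -> set R, (forall i, measurable (A i)) ->
    P [set w | forall i, A i (X i w)] = (\prod_(i < n) P (X i @^-1` A i))%E.

Definition indep_increments (Y : R -> Omega -> R) : Prop :=
  forall (n : nat) (t : nat -> R), 0 <= t 0%N ->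
    (forall i : nat, (i < n)%N -> t i < t i.+1) ->
    mutually_indep (fun (i : 'I_n) w => Y (t i.+1) w - Y (t i) w).

Definition indep_of_process (T : Omega -> R) (Y : R -> Omega -> R) : Prop :=
  forall (n : nat) (ts : 'I_n -> R) (A : set R) (B : 'I_n -> set R),
    (forall i, 0 <= ts i) -> measurable A -> (forall i, measurable (B i)) ->
    P [set w | A (T w) /\ forall i, B i (Y (ts i) w)] =
    (P (T @^-1` A) * P [set w | forall i, B i (Y (ts i) w)])%E.

Definition std_brownian_motion (B : R -> Omega -> R) : Prop :=
  [/\ forall w, B 0 w = 0,
      forall t, measurable_fun setT (B t),
      forall w, {within `[0, +oo[, continuous (fun s => B s w)},
      indep_increments B &
      forall s t (A : set R), 0 <= s -> s < t -> measurable A ->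
        P [set w | A (B t w - B s w)] = normal_prob 0 (Num.sqrt (t - s)) A].

Definition subordinator (H : R -> Omega -> R) (Phi : R -> R) : Prop :=
  (forall w, H 0 w = 0) /\
      (forall t, measurable_fun setT (H t)) /\
      (forall w s t, 0 <= s -> s <= t -> H s w <= H t w) /\
      (forall w t, 0 <= t -> (fun s => H s w) @ at_right t --> H t w) /\
      indep_increments H /\
      (forall s t (A : set R), 0 <= s -> 0 <= t -> measurable A ->
        P [set w | A (H (s + t) w - H s w)] = P [set w | A (H t w)]) /\
      (forall lam t, 0 <= lam -> 0 <= t ->
        ('E_P[fun w => expR (- (lam * H t w))] = (expR (- (t * Phi lam)))%:E)%E).

End defs.

Definition inverse_subordinator {R : realType} {Omega : Type}
  (H : R -> Omega -> R) (t : R) (w : Omega) : R :=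
  inf [set s | 0 < s /\ t < H s w].

Definition running_max {R : realType} {Omega : Type}
  (X : R -> Omega -> R) (t : R) (w : Omega) : R :=
  sup [set y | exists s, 0 <= s <= t /\ y = X s w].

Definition relativistic_exponent {R : realType} (eta : R) (lam : R) : R :=
  Num.sqrt (lam + eta) - Num.sqrt eta.

(* Main.v *)
(** Put [eta = (mu/2)^2] and [theta = mu/2 + sqrt (lam + eta)], so that
    [theta^2 - mu theta = lam] and [exp (theta X_s - lam s)] is a martingale.
    Stopping it at the passage time [tau] of [X] over a level [x > 0] yields
    [E exp (- lam tau) = exp (- theta x) = exp (- mu x) E exp (- lam H_x)] for
    all [lam > 0]; by uniqueness of Laplace transforms, [P (tau <= t)] is
    [exp (- mu x) P (H_x <= t)], which is [P (T > x) P (L_t > x)].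

    Optional stopping is applied on a grid of mesh [N/(m+1)] up to a finite
    horizon [N]. An [L^2] bound controls the overshoot as [m] grows, and the
    error of the Laplace transform at horizon [N] is at most [exp (- lam N)].
    Strict and non-strict inequalities are never compared at the same level:
    all comparisons are sandwiches between nearby levels or nearby times, so
    that no absence of atoms has to be established. *)

Require Import Defs.
From HB Require Import structures.
From mathcomp Require Import all_boot all_order all_algebra.
From mathcomp Require Import all_classical all_reals all_analysis.
From mathcomp Require Import measurable_realfun ring.
Import Order.TTheory GRing.Theory Num.Theory.
Import numFieldNormedType.Exports.
Local Open Scope classical_set_scope.
Local Open Scope ring_scope.

(** The weight [expR (- (mu * x))] comes from [theta = mu + Phi(lam)]: as [lam] tends to 0, [theta]
    tends to [mu], so it is the probability that [X] ever exceeds [x]. With positive probability the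
    level is thus never passed, and the capped passage time leaves a mass of about
    [1 - expR (- (mu * x))] at the horizon. The two sides agree in the limit at every [lam > 0] but
    not at [lam = 0], where they are 1 and [expR (- (mu * x))]. Laplace uniqueness is therefore used
    as a one-sided comparison of weighted distribution functions at two distinct times, with
    polynomials in [expR (- (c * s))] without constant term as test functions: these do not see the
    escaping mass.

    On a grid the walk can jump over [x] by an unbounded amount, so no constant dominates the
    stopped exponentials; this is why a second moment is needed. *)

(** * Product formulas for independent variables and sigma-algebras *)

Section independence.
Context {R : realType} {d : measure_display} {Omega : measurableType d}.
Variable P : probability Omega R.

Lemma ge0_integralD_EFin (f g : Omega -> R) :
  measurable_fun setT f -> measurable_fun setT g ->
  (forall w, 0 <= f w) -> (forall w, 0 <= g w) ->
  (\int[P]_w (f w + g w)%:E = \int[P]_w (f w)%:E + \int[P]_w (g w)%:E)%E.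
Proof.
move=> mf mg f0 g0; under eq_integral do rewrite EFinD.
apply: ge0_integralD => //.
- by move=> w _; rewrite lee_fin.
- exact/measurable_EFinP.
- by move=> w _; rewrite lee_fin.
- exact/measurable_EFinP.
Qed.

(** The law of the pair is the product of the two laws, since both agree on measurable rectangles;
    Tonelli then splits the double integral. *)
Lemma ge0_integral_prod_indep (W V : Omega -> R) :
  measurable_fun setT W -> measurable_fun setT V ->
  (forall w, 0 <= W w) -> (forall w, 0 <= V w) ->
  (forall A B, measurable A -> measurable B ->
    P (W @^-1` A `&` V @^-1` B) = (P (W @^-1` A) * P (V @^-1` B))%E) ->
  (\int[P]_w (W w * V w)%:E = \int[P]_w (W w)%:E * \int[P]_w (V w)%:E)%E.
Proof.
move=> mW mV W0 V0 WV.
pose X : {RV P >-> R} := mfun_Sub (mem_set mW).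
pose Y : {RV P >-> R} := mfun_Sub (mem_set mV).
have mXY : measurable_fun setT (fun w => (W w, V w)) by exact: measurable_fun_pair.
pose Z : {RV P >-> (R * R)%type} := mfun_Sub (mem_set mXY).
(* Absolute values make the integrands nonnegative on the whole line; on the ranges of [W] and [V]
   they change nothing. *)
pose g (x : R) : \bar R := `|x|%:E.
have mabs : measurable_fun setT g.
  by apply/measurable_EFinP; exact: normr_measurable.
pose f (z : R * R) : \bar R := (`|z.1| * `|z.2|)%:E.
have mf : measurable_fun setT f.
  apply/measurable_EFinP; apply: measurable_funM;
    by apply: measurableT_comp.
have g0 x : (0 <= g x)%E by rewrite lee_fin.
have f0 z : (0 <= f z)%E by rewrite lee_fin mulr_ge0.
have -> : (\int[P]_w (W w * V w)%:E = \int[distribution P Z]_z f z)%E.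
  rewrite ge0_integral_distribution//; apply: eq_integral => w _ /=.
  by rewrite /f /= !ger0_norm.
have -> : (\int[P]_w (W w)%:E = \int[distribution P X]_x g x)%E.
  rewrite ge0_integral_distribution//; apply: eq_integral => w _ /=.
  by rewrite /g ger0_norm.
have -> : (\int[P]_w (V w)%:E = \int[distribution P Y]_x g x)%E.
  rewrite ge0_integral_distribution//; apply: eq_integral => w _ /=.
  by rewrite /g ger0_norm.
rewrite (eq_measure_integral (distribution P X \x distribution P Y)%E); last first.
  move=> A mA _.
  apply/esym.
  by apply: (@product_measure_unique _ _ _ _ _ (distribution P X) (distribution P Y)).
rewrite fubini_tonelli1//=.
transitivity (\int[distribution P X]_x (g x * \int[distribution P Y]_y g y))%E.
  apply: eq_integral => x _; rewrite /fubini_F /f /=.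
  under eq_integral do rewrite EFinM.
  by rewrite ge0_integralZl_EFin.
by rewrite ge0_integralZr//; exact: integral_ge0.
Qed.

(** As functions of [F], both sides are finite measures, and they agree on a pi-system containing
    the whole space. *)
Lemma indep_generated (G : set (set Omega)) (D : set Omega) :
  G `<=` measurable -> setI_closed G -> G setT -> measurable D ->
  (forall F, G F -> P (F `&` D) = (P F * P D)%E) ->
  forall F, <<s G >> F -> P (F `&` D) = (P F * P D)%E.
Proof.
move=> Gm GI GT mD GD F GF.
have PDf : P D \is a fin_num by exact: fin_num_measure.
have r0 : 0 <= fine (P D) by exact: fine_ge0.
pose m2 := mscale (NngNum r0) P.
have E2 A : m2 A = (P A * P D)%E by rewrite /m2 /mscale /= fineK// muleC.
rewrite -E2.
apply: (g_sigma_algebra_measure_unique G Gm (fun=> setT) (fun=> GT) _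
  (mrestr P mD) m2) => //.
- by apply/seteqP; split => // w _; exists 0%N.
- by move=> A GA; transitivity (P A * P D)%E; [exact: GD|exact/esym/E2].
- move=> _; apply: le_lt_trans (ltry 1).
  exact: (@probability_le1 _ _ _ P (setT `&` D) (measurableI _ _ measurableT mD)).
Qed.

End independence.

(** * Optional stopping for the exponential martingale of a random walk *)

Section optional_stopping.
Context {R : realType}.
Implicit Types (T : Type) (x c q : R).

Definition walk {T} (xi : nat -> T -> R) (k : nat) (w : T) : R :=
  \sum_(i < k) xi i w.

Fixpoint below {T} (xi : nat -> T -> R) x (k : nat) (w : T) : bool :=
  (if k is k'.+1 then below xi x k' w else true) && (walk xi k w <= x).

(* The first index at which the walk exceeds [x], capped at [k]. *)
Fixpoint passage {T} (xi : nat -> T -> R) x (k : nat) (w : T) : nat :=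
  if k is k'.+1 then
    if below xi x k' w then k'.+1 else passage xi x k' w
  else 0%N.

Lemma passage_below {T} (xi : nat -> T -> R) x k w :
  below xi x k w -> passage xi x k w = k.
Proof. by case: k => //= k /andP[->]. Qed.

(** The exponential martingale of the walk when [q] is the logarithm of the mean of
    [expR (c * xi k)]. *)
Definition expwalk {T} (xi : nat -> T -> R) c q (k : nat) (w : T) : R :=
  expR (c * walk xi k w - q * k%:R).

Lemma measurable_walk d (T : measurableType d) (xi : nat -> T -> R) k :
  (forall i, (i < k)%N -> measurable_fun setT (xi i)) ->
  measurable_fun setT (walk xi k).
Proof.
move=> mxi; rewrite /walk.
elim: k mxi => [|k ih] mxi.
  by under eq_fun do rewrite big_ord0; exact: measurable_cst.
under eq_fun do rewrite big_ord_recr/=.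
apply: measurable_funD; last exact: mxi.
by apply: ih => i ik; apply: mxi; rewrite ltnS ltnW.
Qed.

Lemma measurable_below d (T : measurableType d) (xi : nat -> T -> R) x k :
  (forall i, (i < k)%N -> measurable_fun setT (xi i)) ->
  measurable_fun setT (below xi x k).
Proof.
elim: k => [|k ih] mxi; apply: measurable_and => //.
- by apply: measurable_fun_ler => //; exact: measurable_walk.
- by apply: ih => i ik; apply: mxi; rewrite ltnS ltnW.
- by apply: measurable_fun_ler => //; exact: measurable_walk.
Qed.

Lemma measurable_expwalk d (T : measurableType d) (xi : nat -> T -> R) c q k :
  (forall i, (i < k)%N -> measurable_fun setT (xi i)) ->
  measurable_fun setT (expwalk xi c q k).
Proof.
move=> mxi; apply: measurableT_comp => //; apply: measurable_funB => //.
by apply: measurable_funM => //; exact: measurable_walk.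
Qed.

Lemma measurable_passage_comp d (T : measurableType d) (xi : nat -> T -> R) x
    (F : nat -> T -> R) k :
  (forall i, (i < k)%N -> measurable_fun setT (xi i)) ->
  (forall i, (i <= k)%N -> measurable_fun setT (F i)) ->
  measurable_fun setT (fun w => F (passage xi x k w) w).
Proof.
elim: k => [|k ih] mxi mF /=; first exact: mF.
rewrite [X in measurable_fun _ X](_ : _ = fun w =>
    if below xi x k w then F k.+1 w else F (passage xi x k w) w).
  apply: measurable_fun_ifT; last 1 first.
  - by apply: ih => i ik; [apply: mxi; rewrite ltnS ltnW|apply: mF; exact: leqW].
  - by apply: measurable_below => i ik; apply: mxi; rewrite ltnS ltnW.
  - exact: mF.
by apply/funext => w; case: ifP.
Qed.

Context d (Omega : measurableType d) (P : probability Omega R).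
Variable xi : nat -> Omega -> R.
Hypothesis mxi : forall i, measurable_fun setT (xi i).
Hypothesis indep_xi : forall n, mutually_indep P (fun i : 'I_n => xi i).

(** Cylinder events of the first [k] steps: a pi-system that generates the past of the walk.
    Indexing [A] by all of [nat] avoids dependent indices. *)
Definition past (k : nat) : set (set Omega) :=
  [set F | exists2 A : nat -> set R, (forall i, measurable (A i)) &
     F = [set w | forall i, (i < k)%N -> A i (xi i w)]].

Lemma past_measurable k : past k `<=` measurable.
Proof.
move=> _ [A mA ->].
rewrite (_ : mkset _ = \bigcap_(i in [set i | (i < k)%N]) (xi i @^-1` A i)).
  apply: bigcap_measurableType.
  by move=> i _; rewrite -[X in measurable X]setTI; exact: mxi.
by apply/seteqP; split.
Qed.

Lemma past_setI k : setI_closed (past k).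
Proof.
move=> _ _ [A mA ->] [B mB ->]; exists (fun i => A i `&` B i).
  by move=> i; exact: measurableI.
apply/seteqP; split => w /=.
  by move=> [Aw Bw] i ik; split; [exact: Aw|exact: Bw].
by move=> H; split => i /H[].
Qed.

(** On cylinders this is the mutual independence of [k + 1] steps, with [A] appended as the
    constraint on the last one; [indep_generated] extends it to the sigma-algebra. *)
Lemma past_indep k F (A : set R) : <<s past k >> F -> measurable A ->
  P (F `&` xi k @^-1` A) = (P F * P (xi k @^-1` A))%E.
Proof.
move=> pF mA; apply: indep_generated pF.
- exact: past_measurable.
- exact: past_setI.
- by exists (fun=> setT) => //; apply/seteqP; split.
- by rewrite -[X in measurable X]setTI; exact: mxi.
move=> _ [B mB ->].
have -> : [set w | forall i, (i < k)%N -> B i (xi i w)] =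
    [set w | forall i : 'I_k, B i (xi i w)].
  by apply/seteqP; split=> w H i => [|ik]; [exact: H|exact: (H (Ordinal ik))].
rewrite (indep_xi _ (fun i : 'I_k => B i))//.
pose B' (i : 'I_k.+1) := if (i < k)%N then B i else A.
have -> : [set w | forall i : 'I_k, B i (xi i w)] `&` xi k @^-1` A =
    [set w | forall i : 'I_k.+1, B' i (xi i w)].
  apply/seteqP; split => w /=.
    move=> [Bw Aw] i; rewrite /B'; case: ifPn => ik.
      exact: (Bw (Ordinal ik)).
    suff -> : i = k :> nat by [].
    by apply/eqP; rewrite eqn_leq -ltnS ltn_ord /= leqNgt.
  move=> H; split => [i|].
    by have := H (widen_ord (leqnSn k) i); rewrite /B' /= ltn_ord.
  by have := H ord_max; rewrite /B' /= ltnn.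
rewrite (indep_xi _ B'); last by move=> i; rewrite /B'; case: ifP.
rewrite big_ord_recr /=; congr (_ * P _)%E; last by rewrite /B' /= ltnn.
by apply: eq_bigr => i _; rewrite /B' /= ltn_ord.
Qed.

Variables (x c q : R).
Hypothesis mart : forall k, (\int[P]_w (expR (c * xi k w - q))%:E = 1)%E.

(** Raising the cap from [k] to [k + 1] only affects the paths still below [x] after [k] steps;
    there the value is multiplied by a factor of mean 1 that is independent of the past. *)
Lemma integral_stopped_expwalk k :
  (\int[P]_w (expwalk xi c q (passage xi x k w) w)%:E = 1)%E.
Proof.
elim: k => [|k ih].
  under eq_integral do rewrite /expwalk/= /walk big_ord0 !mulr0 subr0 expR0.
  by rewrite integral_cst//= probability_setT mule1.
(* [W] is the value on the paths still running, [V] the next factor, [Z] the value already frozen: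
   the integrand is [W + Z] at cap [k] and [W * V + Z] at cap [k + 1]. *)
pose W w := if below xi x k w then expwalk xi c q k w else 0.
pose V w := expR (c * xi k w - q).
pose Z w := if below xi x k w then 0 else expwalk xi c q (passage xi x k w) w.
have mb : measurable_fun setT (below xi x k) by exact: measurable_below.
have mW : measurable_fun setT W.
  by apply: measurable_fun_ifT => //; exact: measurable_expwalk.
have mV : measurable_fun setT V.
  by apply: measurableT_comp => //; apply: measurable_funB => //;
    apply: measurable_funM.
have mZ : measurable_fun setT Z.
  apply: measurable_fun_ifT => //.
  apply: (measurable_passage_comp _ _ _ x (expwalk xi c q)) => // i _.
  exact: measurable_expwalk.
have W0 w : 0 <= W w by rewrite /W; case: ifP => // _; exact: expR_ge0.
have V0 w : 0 <= V w by exact: expR_ge0.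
have Z0 w : 0 <= Z w by rewrite /Z; case: ifP => // _; exact: expR_ge0.
have WV : (\int[P]_w (W w * V w)%:E = \int[P]_w (W w)%:E)%E.
  rewrite ge0_integral_prod_indep// ?mart ?mule1// => A B mA mB.
  have mg : measurable_fun setT (fun y : R => expR (c * y - q)).
    by apply: measurableT_comp => //; apply: measurable_funB => //;
      apply: measurable_funM.
  apply: (past_indep k _ ((fun y => expR (c * y - q)) @^-1` B)); last first.
    by rewrite -[X in measurable X]setTI; exact: mg.
  (* The measurability lemmas hold over any sigma-algebra; applied over the one generated by
     [past k], they show that [W] depends on the first [k] steps only. *)
  have mxi' i : (i < k)%N ->
      measurable_fun setT (xi i : g_sigma_algebraType (past k) -> R).
    move=> ik _ C mC; rewrite setTI; apply: sub_sigma_algebra.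
    exists (fun j => if j == i then C else setT).
      by move=> j; case: ifP.
    apply/seteqP; split => w /=; last by move=> /(_ i ik); rewrite eqxx.
    by move=> Cw j jk; case: eqP => // ->.
  have mW' : measurable_fun setT (W : g_sigma_algebraType (past k) -> R).
    apply: measurable_fun_ifT => //; first exact: measurable_below.
    exact: measurable_expwalk.
  by have := mW' measurableT A mA; rewrite setTI.
transitivity (\int[P]_w (W w * V w + Z w)%:E)%E.
  apply: eq_integral => w _; congr (_%:E).
  rewrite /W /V /Z /=; case: ifP => bw; last by rewrite mul0r add0r.
  rewrite addr0 -expRD /expwalk /walk big_ord_recr /= -natr1; congr expR; ring.
rewrite (ge0_integralD_EFin _ (fun w => W w * V w))//; last 2 first.
- exact: measurable_funM.
- by move=> w; rewrite mulr_ge0.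
rewrite WV -ge0_integralD_EFin// -ih.
apply: eq_integral => w _; congr (_%:E).
rewrite /W /Z; case: ifP => bw; last by rewrite add0r.
by rewrite addr0 passage_below.
Qed.

End optional_stopping.

(** * Pathwise properties of the passage index *)

Section passage_index.
Context {R : realType} {T : Type}.
Variables (xi : nat -> T -> R) (x : R).

Lemma belowP k w : below xi x k w <-> forall j, (j <= k)%N -> walk xi j w <= x.
Proof.
elim: k => [|k ih].
  by split => [/= + j|H]; [rewrite leqn0 => + /eqP ->|exact: H].
split => [/andP[/ih bk wk] j|H].
  by rewrite leq_eqVlt ltnS => /orP[/eqP ->//|]; exact: bk.
by apply/andP; split; [apply/ih => j jk; apply: H; exact: leqW|exact: H].
Qed.

Lemma passage_le k w : (passage xi x k w <= k)%N.
Proof. by elim: k => //= k ih; case: ifP => // _; exact: leqW. Qed.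

Lemma walk_passage k w : (passage xi x k w < k)%N ->
  x < walk xi (passage xi x k w) w.
Proof.
elim: k => // k ih /=; case: ifPn => [_|nb _]; first by rewrite ltnn.
have := passage_le k w; rewrite leq_eqVlt => /orP[/eqP pk|]; last exact: ih.
(* Some step up to [k] exceeds [x]. Were it a step [j < k], the index would be at most [j] and not
   [k]; so it is step [k] itself. *)
rewrite pk ltNge; apply: contra nb => wk; apply/belowP => j.
rewrite leq_eqVlt => /orP[/eqP ->//|jk]; rewrite leNgt; apply/negP => wj.
have : (passage xi x k w <= j)%N.
  move: wj jk {ih wk}; rewrite -pk.
  elim: k {pk} => //= k ih wj; case: ifPn => [/belowP b|_].
    by rewrite ltnS => /b; rewrite leNgt wj.
  exact: ih.
by rewrite pk leqNgt jk.
Qed.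

Lemma passage_le_hit k j w : (j <= k)%N -> x < walk xi j w ->
  (passage xi x k w <= j)%N.
Proof.
move=> + wj; elim: k => //= k ih.
rewrite leq_eqVlt => /orP[/eqP ->|]; first by case: ifP => // _; exact/leqW/passage_le.
rewrite ltnS => jk; case: ifPn => [/belowP/(_ _ jk)|_]; last exact: ih.
by rewrite leNgt wj.
Qed.

End passage_index.

(** * Passage times of a continuous path and their grid approximation *)

Section paths.
Context {R : realType}.
Implicit Types (f : R -> R) (x s t N e : R).

(** The passage time capped at [N]: adjoining [N] keeps the set nonempty, and a path that stays at
    or below [x] up to [N] gets the value [N]. *)
Definition passage_time f x N : R :=
  inf ([set s | 0 <= s <= N /\ x < f s] `|` [set N]).

Variable f : R -> R.
Hypothesis cf : {within `[0, +oo[, continuous f}.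

Lemma path_continuousP s e : 0 <= s -> 0 < e ->
  exists2 del, 0 < del &
    forall u, 0 <= u -> `|u - s| < del -> `|f u - f s| < e.
Proof.
move=> s0 e0.
have sI : `[0, +oo[%classic s by rewrite /= in_itv/= s0.
have := (subspace_continuousP _ _).1 cf s sI.
move=> /cvgrPdist_lt /(_ _ e0); rewrite near_withinE => /nbhs_ballP[del del0 H].
exists del => // u u0 us; rewrite distrC; apply: H.
  by rewrite /ball /= distrC.
by rewrite /= in_itv/= u0.
Qed.

Lemma path_bounded t : 0 <= t ->
  has_sup [set y | exists s, 0 <= s <= t /\ y = f s].
Proof.
move=> t0; split; first by exists (f 0), 0; rewrite lexx t0.
have cft : {within `[0, t], continuous f}.
  apply: continuous_subspaceW cf => u /=; rewrite !in_itv/= andbT.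
  by case/andP.
have [c _ fc] := EVT_max t0 cft.
by exists (f c) => _ [s [st ->]]; apply: fc; rewrite in_itv/=.
Qed.

Section passage_time.
Variables (x N : R).
Hypothesis N0 : 0 <= N.

Let S := [set s | 0 <= s <= N /\ x < f s] `|` [set N].

Let S_inf : has_inf S.
Proof.
split; first by exists N; right.
by exists 0 => s [[/andP[]]|->].
Qed.

Lemma passage_time_ge0 : 0 <= passage_time f x N.
Proof. by apply: lb_le_inf; [case: S_inf|move=> s [[/andP[]]|->]]. Qed.

Lemma passage_time_leN : passage_time f x N <= N.
Proof. by apply: ge_inf; [case: S_inf|right]. Qed.

Lemma passage_time_le s : 0 <= s <= N -> x < f s -> passage_time f x N <= s.
Proof. by move=> sN xf; apply: ge_inf; [case: S_inf|left]. Qed.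

Lemma passage_time_adherent e : 0 < e -> passage_time f x N < N ->
  exists s, [/\ 0 <= s <= N, x < f s & s < passage_time f x N + e].
Proof.
move=> e0 ptN.
pose e' := Num.min e (N - passage_time f x N).
have e'0 : 0 < e' by rewrite lt_min e0 subr_gt0.
have [s [[sN xs] se|->]] := inf_adherent e'0 S_inf.
  exists s; split => //; apply: (lt_le_trans se).
  by rewrite lerD2l ge_min lexx.
rewrite -/(passage_time f x N) -ltrBlDl lt_min ltxx andbF //.
Qed.

(** If the path were above [x] at this time, it would by continuity already be above [x] slightly
    earlier; earlier times exist because the path starts at or below [x]. *)
Lemma path_passage_time_le : f 0 <= x -> f (passage_time f x N) <= x.
Proof.
move=> f0; rewrite leNgt; apply/negP => xf.
set p := passage_time f x N in xf *.
have p0 : 0 <= p := passage_time_ge0.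
have fx : 0 < f p - x by rewrite subr_gt0.
have [del del0 H] := path_continuousP p _ p0 fx.
have pp : 0 < p.
  by rewrite lt_neqAle p0 andbT; apply: contraTneq xf => <-; rewrite -leNgt.
pose u := p - Num.min (del / 2) p.
have m0 : 0 < Num.min (del / 2) p by rewrite lt_min pp andbT divr_gt0.
have u0 : 0 <= u by rewrite subr_ge0 ge_min lexx orbT.
have up : u < p by rewrite ltrBlDr ltrDl.
have : `|f u - f p| < f p - x.
  apply: H => //; rewrite /u addrAC subrr add0r normrN gtr0_norm//.
  by rewrite gt_min; apply/orP; left; rewrite ltr_pdivrMr// mulr_natr mulr2n ltrDl.
rewrite ltr_distl opprB addrCA subrr addr0 => /andP[xu _].
suff : p <= u by rewrite leNgt up.
by apply: passage_time_le => //; rewrite u0 (le_trans (ltW up) passage_time_leN).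
Qed.

(** Exceedance times accumulate at the passage time from the right. With the previous lemma, a
    continuous path does not overshoot: it is at [x] exactly, unless the cap is reached. *)
Lemma path_passage_time_ge : passage_time f x N < N ->
  x <= f (passage_time f x N).
Proof.
move=> pN; rewrite leNgt; apply/negP => xf.
set p := passage_time f x N in xf pN *.
have fx : 0 < x - f p by rewrite subr_gt0.
have [del del0 H] := path_continuousP p _ passage_time_ge0 fx.
have [s [/andP[s0 sN] xs sp]] := passage_time_adherent del del0 pN.
have ps : p <= s by apply: passage_time_le => //; rewrite s0.
have := H s s0; rewrite ger0_norm ?subr_ge0// ltrBlDl => /(_ sp).
by rewrite ltr_distl addrCA subrr addr0 => /andP[_]; rewrite ltNge (ltW xs).
Qed.

End passage_time.

(** The grid point just before [s] works as soon as the mesh is smaller than the modulus of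
    continuity at [s]. *)
Lemma grid_approx x N s e : 0 < N -> 0 <= s <= N -> x < f s -> 0 < e ->
  exists m0 : nat, forall m, (m0 <= m)%N -> exists k : nat,
    [/\ (k <= m.+1)%N, k%:R * (N / m.+1%:R) < s + e
      & x < f (k%:R * (N / m.+1%:R))].
Proof.
move=> N0 /andP[s0 sN] xs e0.
have fx : 0 < f s - x by rewrite subr_gt0.
have [del del0 H] := path_continuousP s _ s0 fx.
(* From this index on, [m + 1 > N / del], so the mesh is less than [del]. *)
exists (Num.truncn (N / del)) => m m0.
have m1 : 0 < m.+1%:R :> R by [].
pose h := N / m.+1%:R.
have h0 : 0 < h by rewrite divr_gt0.
have hd : h < del.
  rewrite ltr_pdivrMr// -ltr_pdivrMl// mulrC.
  apply: lt_le_trans (truncnS_gt _) _; by rewrite ler_nat ltnS.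
have sh : 0 <= s / h by rewrite divr_ge0// ltW.
have /andP[k1 k2] := truncn_itv sh.
move: k1; rewrite ler_pdivlMr// => k1.
move: k2; rewrite ltr_pdivrMr// -natr1 mulrDl mul1r => k2.
exists (Num.truncn (s / h)); rewrite -/h; split.
- rewrite -(ler_nat R) -(ler_pM2r h0); apply: (le_trans k1).
  by rewrite /h mulrCA divff ?mulr1// gt_eqF.
- by rewrite (le_lt_trans k1)// ltrDl.
- set u := _ * h in k1 k2 *.
  have u0 : 0 <= u by rewrite mulr_ge0// ltW.
  have : `|f u - f s| < f s - x.
    apply: H => //; rewrite distrC ger0_norm ?subr_ge0// ltrBlDl.
    by rewrite (lt_trans k2)// ltrD2l.
  by rewrite ltr_distl opprB addrCA subrr addr0 => /andP[].
Qed.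

Lemma running_max_gtP x t : 0 < t ->
  x < sup [set y | exists s, 0 <= s <= t /\ y = f s] <->
  exists s, 0 <= s <= t /\ x < f s.
Proof.
move=> t0; have hs := path_bounded t (ltW t0); split => [xM|[s [st xs]]].
  move: (xM); rewrite -subr_gt0 => xM0.
  have [_ [s [st ->]] xs] := sup_adherent xM0 hs.
  by exists s; split => //; move: xs; rewrite opprB addrCA subrr addr0.
by apply: lt_le_trans xs _; apply: ub_le_sup; [case: hs|exists s].
Qed.

(** Grid passage is never earlier than true passage. Conversely, an exceedance shortly after the
    true passage is matched by a grid point; if the true passage is at the cap, both times equal
    [N]. *)
Lemma passage_grid_cvg (T : Type) (xi : nat -> nat -> T -> R) x N w : 0 < N ->
  (forall m k, (k <= m.+1)%N ->
     walk (xi m) k w = f (k%:R * (N / m.+1%:R))) ->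
  (passage (xi m) x m.+1 w)%:R * (N / m.+1%:R) @[m --> \oo] -->
    passage_time f x N.
Proof.
move=> N0 xiE; apply/cvgrPdist_lt => e e0.
have N0' := ltW N0.
have uN m k : (k <= m.+1)%N -> 0 <= k%:R * (N / m.+1%:R) <= N.
  move=> km; rewrite mulr_ge0 ?divr_ge0//= mulrA ler_pdivrMr// mulrC.
  by rewrite ler_pM2l// ler_nat.
have pu m : passage_time f x N <= (passage (xi m) x m.+1 w)%:R * (N / m.+1%:R).
  have := passage_le (xi m) x m.+1 w; rewrite leq_eqVlt => /orP[/eqP ->|km].
    by rewrite mulrCA divff// mulr1 passage_time_leN.
  apply: passage_time_le => //; first exact/uN/ltnW.
  rewrite -xiE; last exact: ltnW.
  exact: walk_passage.
have [pN|pN] := ltP (passage_time f x N) N.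
  have e2 : 0 < e / 2 by rewrite divr_gt0.
  have [s [sN xs se]] := passage_time_adherent x N N0' (e / 2) e2 pN.
  have [m0 Hm] := grid_approx x N s (e / 2) N0 sN xs e2.
  exists m0 => // m /Hm[k [km ks xk]].
  rewrite distrC ger0_norm ?subr_ge0// ltrBlDl.
  have pk : (passage (xi m) x m.+1 w <= k)%N.
    by apply: passage_le_hit => //; rewrite xiE.
  apply: (@le_lt_trans _ _ (k%:R * (N / m.+1%:R))).
    by rewrite ler_wpM2r ?divr_ge0// ler_nat.
  by rewrite (lt_trans ks)// -ltrBrDr (lt_le_trans se)// {2}(splitr e) addrA addrK.
exists 0%N => // m _; rewrite distrC ger0_norm ?subr_ge0// ltrBlDl.
have /andP[_ uN'] := uN m _ (passage_le (xi m) x m.+1 w).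
by rewrite (le_lt_trans uN')// (le_lt_trans pN)// ltrDl.
Qed.

Lemma path_cvg_comp (u : nat -> R) (p : R) : (forall m, 0 <= u m) -> 0 <= p ->
  u m @[m --> \oo] --> p -> f (u m) @[m --> \oo] --> f p.
Proof.
move=> u0 p0 /cvgrPdist_lt up; apply/cvgrPdist_lt => e e0.
have [del del0 H] := path_continuousP p e p0 e0.
near=> m; rewrite distrC; apply: H => //; rewrite distrC.
by near: m; exact: up.
Unshelve. all: by end_near. Qed.

End paths.

(** * Moment generating function of a centred normal law *)

Section normal_mgf.
Context {R : realType}.
Local Notation leb := (@lebesgue_measure R).

(** The Radon-Nikodym derivative and the explicit density have the same integral over every
    measurable set, hence agree almost everywhere. *)
Lemma ge0_integral_normal_prob (m s : R) (f : R -> \bar R) :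
  (forall x, (0 <= f x)%E) -> measurable_fun setT f ->
  (\int[normal_prob m s]_x f x = \int[leb]_x (f x * (normal_pdf m s x)%:E))%E.
Proof.
move=> f0 mf; have dom := normal_prob_dominates m s.
have mpdf : measurable_fun setT (EFin \o normal_pdf m s).
  by apply/measurable_EFinP; exact: measurable_normal_pdf.
have RNi := Radon_Nikodym_SigmaFinite.f_integrable dom.
rewrite -(Radon_Nikodym_SigmaFinite.change_of_variables dom f0 measurableT mf).
apply: ae_eq_integral => //.
- by apply: emeasurable_funM => //; exact: measurable_int RNi.
- exact: emeasurable_funM.
apply: ae_eqe_mul2l; apply: integral_ae_eq => // E _ mE.
by rewrite -Radon_Nikodym_SigmaFinite.f_integral.
Qed.

(** Completing the square: the exponential tilt turns the density into a constant times the normal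
    density of mean [a * s ^+ 2]. *)
Lemma normal_prob_mgf (s a : R) : s != 0 ->
  (\int[normal_prob 0 s]_x (expR (a * x))%:E = (expR (a ^+ 2 * s ^+ 2 / 2))%:E)%E.
Proof.
move=> s0; rewrite ge0_integral_normal_prob; last 2 first.
- by move=> x; rewrite lee_fin expR_ge0.
- by apply/measurable_EFinP; apply: measurableT_comp => //; exact: mulrl_measurable.
transitivity (\int[leb]_x
   ((expR (a ^+ 2 * s ^+ 2 / 2))%:E * (normal_pdf (a * s ^+ 2) s x)%:E))%E.
  apply: eq_integral => x _; rewrite -!EFinM !normal_pdfE//; congr (_%:E).
  rewrite mulrCA [RHS]mulrCA; congr (_ * _); rewrite /normal_fun -!expRD; congr expR.
  by field; rewrite s0.
rewrite ge0_integralZl_EFin ?expR_ge0//; last 2 first.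
- by move=> x _; rewrite lee_fin normal_pdf_ge0.
- by apply/measurable_EFinP; exact: measurable_normal_pdf.
by rewrite integral_normal_pdf mule1.
Qed.

End normal_mgf.

(** * Passing to the limit in expectations *)

Section uniform_integrability.
Context {R : realType} {d : measure_display} {Omega : measurableType d}.
Variable P : probability Omega R.

Lemma le_integral_EFin (f g : Omega -> R) :
  measurable_fun setT f -> measurable_fun setT g ->
  (forall w, 0 <= f w) -> (forall w, f w <= g w) ->
  (\int[P]_w (f w)%:E <= \int[P]_w (g w)%:E)%E.
Proof.
move=> mf mg f0 fg; apply: ge0_le_integral => //.
- by move=> w _; rewrite lee_fin.
- exact/measurable_EFinP.
- exact/measurable_EFinP.
- by move=> w _; rewrite lee_fin.
Qed.

Lemma ge0_integralZl_R (f : Omega -> R) (k : R) :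
  measurable_fun setT f -> (forall w, 0 <= f w) -> 0 <= k ->
  (\int[P]_w (k * f w)%:E = k%:E * \int[P]_w (f w)%:E)%E.
Proof.
move=> mf f0 k0; under eq_integral do rewrite EFinM.
apply: ge0_integralZl_EFin => //; first by move=> w _; rewrite lee_fin.
exact/measurable_EFinP.
Qed.

Lemma bounded_integral_cvg (f_ : nat -> Omega -> R) (f : Omega -> R) (K : R) :
  (forall n, measurable_fun setT (f_ n)) -> measurable_fun setT f ->
  (forall n w, 0 <= f_ n w <= K) ->
  (forall w, f_ n w @[n --> \oo] --> f w) ->
  (\int[P]_w (f_ n w)%:E @[n --> \oo] --> \int[P]_w (f w)%:E)%E.
Proof.
move=> mf_ mf fK ff.
have [] := @dominated_convergence _ _ _ P setT measurableT
  (fun n w => (f_ n w)%:E) (fun w => (f w)%:E) (cst K%:E).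
- by move=> n; exact/measurable_EFinP.
- exact/measurable_EFinP.
- by apply: aeW => w _; apply/cvg_EFin; [exact: nearW|exact: ff].
- exact: finite_measure_integrable_cst.
- apply: aeW => w n _ /=; have /andP[? ?] := fK n w.
  by rewrite lee_fin ger0_norm.
by [].
Qed.

(* [Z - min Z K <= Z ^ 2 / K], so an [L^2] bound lets expectations pass to the limit. *)
Lemma integral_cvg_L2_bounded (Z : nat -> Omega -> R) (Y : Omega -> R) (C : R) :
  (forall n, measurable_fun setT (Z n)) -> (forall n w, 0 <= Z n w) ->
  (forall w, Z n w @[n --> \oo] --> Y w) ->
  (forall n, \int[P]_w (Z n w)%:E = 1)%E ->
  (forall n, \int[P]_w (Z n w ^+ 2)%:E <= C%:E)%E ->
  (\int[P]_w (Y w)%:E = 1)%E.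
Proof.
move=> mZ Z0 ZY Z1 Z2.
have mY : measurable_fun setT Y.
  by apply: (measurable_fun_cvg mZ) => w _; exact: ZY.
have Y0 w : 0 <= Y w.
  by apply: (ler_cvg_to (cvg_cst 0) (ZY w)); exact: nearW.
(* At a fixed truncation level dominated convergence handles the limit in [n]; the level is then
   raised by monotone convergence. *)
pose J (k : nat) := (\int[P]_w (Num.min (Y w) k.+1%:R)%:E)%E.
have minm (f : Omega -> R) (k : nat) : measurable_fun setT f ->
    measurable_fun setT (fun w => Num.min (f w) k.+1%:R).
  by move=> mf; exact: measurable_minr.
have JZ k : (\int[P]_w (Num.min (Z n w) k.+1%:R)%:E @[n --> \oo] --> J k)%E.
  apply: (bounded_integral_cvg _ _ k.+1%:R).
  - by move=> n; exact: minm.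
  - exact: minm.
  - by move=> n w; rewrite le_min Z0 ler0n/= ge_min lexx orbT.
  (* Writing the minimum with an absolute value reduces its convergence to that of sums, norms and
     products. *)
  - move=> w; under eq_fun do rewrite minr_absE; rewrite minr_absE.
    apply: cvgM; last exact: cvg_cst.
    by apply: cvgB; [apply: cvgD|apply: cvg_norm; apply: cvgB];
      do ?[exact: ZY|exact: cvg_cst].
have Jle k : (J k <= 1)%E.
  apply: cvge_le (JZ k); apply: nearW => n; rewrite -(Z1 n).
  apply: le_integral_EFin => //; first exact: minm.
    by move=> w; rewrite le_min Z0 ler0n.
  by move=> w; rewrite ge_min lexx.
have Jge k : ((1 - C / k.+1%:R)%:E <= J k)%E.
  apply: cvge_ge (JZ k); apply: nearW => n.
  rewrite EFinB leeBlDr//.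
  apply: (@le_trans _ _ (\int[P]_w (Num.min (Z n w) k.+1%:R + k.+1%:R^-1 * Z n w ^+ 2)%:E)%E).
    rewrite -(Z1 n); apply: le_integral_EFin => //.
      apply: measurable_funD; first exact: minm.
      by apply: measurable_funM => //; exact: measurable_funX.
    move=> w; have [zk|zk] := leP (Z n w) k.+1%:R.
      by rewrite lerDl mulr_ge0// sqr_ge0.
    rewrite -[leLHS]add0r lerD//.
    by rewrite -ler_pdivrMl ?invr_gt0// invrK expr2 ler_wpM2r// ltW.
  rewrite (ge0_integralD_EFin _ (fun w => Num.min (Z n w) k.+1%:R))//; last 4 first.
  - exact: minm.
  - by apply: measurable_funM => //; exact: measurable_funX.
  - by move=> w; rewrite le_min Z0 ler0n.
  - by move=> w; rewrite mulr_ge0// sqr_ge0.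
  rewrite leeD2l//.
  rewrite (ge0_integralZl_R (fun w => Z n w ^+ 2))//; last 2 first.
  - exact: measurable_funX.
  - by move=> w; exact: sqr_ge0.
  by rewrite mulrC EFinM lee_wpmul2l// lee_fin invr_ge0.
have JY : (J k @[k --> \oo] --> \int[P]_w (Y w)%:E)%E.
  rewrite (_ : (\int[P]_w (Y w)%:E)%E =
      (\int[P]_w limn (fun k : nat => (Num.min (Y w) k.+1%:R)%:E))%E).
    apply: cvg_monotone_convergence => //.
    - by move=> k; apply/measurable_EFinP; exact: minm.
    - by move=> k w _; rewrite lee_fin le_min Y0 ler0n.
    - move=> w _ a b ab; rewrite lee_fin le_min ge_min lexx/=.
      by rewrite ge_min ler_nat ltnS ab orbT.
  apply: eq_integral => w _; apply/esym/cvg_lim => //.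
  apply: cvg_near_cst.
  exists (Num.truncn (Y w)) => // k /= kY; congr (_%:E).
  apply/min_idPl; apply: (le_trans (ltW (truncnS_gt _))).
  by rewrite ler_nat ltnS.
apply/eqP; rewrite eq_le; apply/andP; split.
  by apply: cvge_le JY; exact: nearW.
have C1 : ((1 - C / k.+1%:R)%:E @[k --> \oo] --> 1%:E)%E.
  apply: cvg_EFin; first exact: nearW.
  rewrite -[X in _ --> X]subr0; apply: cvgB; first exact: cvg_cst.
  rewrite -[X in _ --> X](mulr0 C); apply: cvgM; first exact: cvg_cst.
  exact: cvg_harmonic.
by apply: (lee_cvg_to C1 JY); exact: nearW.
Qed.

End uniform_integrability.

(** * Laplace transform of the passage time of Brownian motion with drift *)

Section drifted_brownian.
Context {R : realType} {d : measure_display} {Omega : measurableType d}.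
Variables (P : probability Omega R) (mu : R) (B : R -> Omega -> R).
Hypothesis hB : std_brownian_motion P B.

Definition drifted (s : R) (w : Omega) : R := - (mu * s) + Num.sqrt 2 * B s w.

Lemma drifted0 w : drifted 0 w = 0.
Proof. by case: hB => B0 _ _ _ _; rewrite /drifted B0 !mulr0 oppr0 addr0. Qed.

Lemma measurable_drifted s : measurable_fun setT (drifted s).
Proof.
case: hB => _ mB _ _ _; apply: measurable_funD => //.
exact: measurable_funM.
Qed.

Lemma continuous_drifted w :
  {within `[0, +oo[, continuous (fun s => drifted s w)}.
Proof.
case: hB => _ _ cB _ _.
apply/subspace_continuousP => s sI.
apply: cvgD.
  apply: cvgN; apply: cvgM; first exact: cvg_cst.
  exact: cvg_within.
apply: cvgM; first exact: cvg_cst.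
exact: (subspace_continuousP _ _).1 (cB w) s sI.
Qed.

Section grid.
Variable h : R.
Hypothesis h0 : 0 < h.

Definition grid_step (i : nat) (w : Omega) : R :=
  - (mu * h) + Num.sqrt 2 * (B (i.+1%:R * h) w - B (i%:R * h) w).

Lemma walk_grid_step k w : walk grid_step k w = drifted (k%:R * h) w.
Proof.
rewrite /walk; elim: k => [|k ih].
  by rewrite big_ord0 mul0r drifted0.
by rewrite big_ord_recr/= ih /drifted /grid_step -natr1; ring.
Qed.

Lemma measurable_grid_step i : measurable_fun setT (grid_step i).
Proof.
case: hB => _ mB _ _ _; apply: measurable_funD => //.
by apply: measurable_funM => //; exact: measurable_funB.
Qed.

Lemma indep_grid_step n : mutually_indep P (fun i : 'I_n => grid_step i).
Proof.
case: hB => _ _ _ iB _ A mA.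
have mg : measurable_fun setT (fun y : R => - (mu * h) + Num.sqrt 2 * y).
  by apply: measurable_funD => //; exact: mulrl_measurable.
apply: (iB n (fun i : nat => i%:R * h) _ _
  (fun i => (fun y => - (mu * h) + Num.sqrt 2 * y) @^-1` A i)).
- by rewrite mul0r.
- by move=> i _; rewrite ltr_pM2r// ltr_nat.
- by move=> i; rewrite -[X in measurable X]setTI; exact: mg.
Qed.

(** A step is normal with mean [- (mu * h)] and variance [2 * h], so its cumulant at [c] is
    [(c ^+ 2 - mu * c) * h]. *)
Lemma integral_exp_grid_step (c : R) k :
  (\int[P]_w (expR (c * grid_step k w - (c ^+ 2 - mu * c) * h))%:E = 1)%E.
Proof.
case: hB => _ mB _ _ nB.
pose D w := B (k.+1%:R * h) w - B (k%:R * h) w.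
have mD : measurable_fun setT (D : Omega -> measurableTypeR R).
  exact: measurable_funB.
pose X : {RV P >-> measurableTypeR R} :=
  @mfun_Sub _ _ Omega (measurableTypeR R) D (mem_set mD).
have s0 : Num.sqrt h != 0 by rewrite gt_eqF// sqrtr_gt0.
pose g (y : R) : \bar R := (expR (c * Num.sqrt 2 * y))%:E.
have mg : measurable_fun setT (g : measurableTypeR R -> \bar R).
  by apply/measurable_EFinP; apply: measurableT_comp => //; exact: mulrl_measurable.
have gD : (\int[P]_w g (D w) = \int[normal_prob 0 (Num.sqrt h)]_y g y)%E.
  transitivity (\int[distribution P X]_y g y)%E.
    apply/esym/ge0_integral_distribution => // y.
    by rewrite lee_fin expR_ge0.
  apply: eq_measure_integral => A mA _; rewrite /distribution /pushforward /=.
  have := nB (k%:R * h) (k.+1%:R * h) A.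
  rewrite (_ : k.+1%:R * h - k%:R * h = h); last by rewrite -natr1; ring.
  by apply => //; rewrite ?mulr_ge0 ?(ltW h0)// ltr_pM2r// ltr_nat.
transitivity (\int[P]_w ((expR (- (c ^+ 2 * h)))%:E * g (D w)))%E.
  apply: eq_integral => w _; rewrite /g/= -EFinM -expRD /grid_step -/(D w).
  by congr ((expR _)%:E); ring.
rewrite ge0_integralZl_EFin ?expR_ge0//; last 2 first.
- by move=> w _; rewrite lee_fin expR_ge0.
- exact: (measurableT_comp mg mD).
rewrite gD.
rewrite normal_prob_mgf// -EFinM -expRD sqr_sqrtr ?(ltW h0)//.
rewrite exprMn sqr_sqrtr// (_ : _ + _ = 0) ?expR0//.
by field.
Qed.

End grid.

Variables (x N : R).
Hypotheses (x0 : 0 <= x) (N0 : 0 < N).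

Local Notation tau w := (passage_time (fun s => drifted s w) x N).

Let step m := grid_step (N / m.+1%:R).

Let tau_ m w := (passage (step m) x m.+1 w)%:R * (N / m.+1%:R).

Let h0 m : 0 < N / m.+1%:R :> R. Proof. by rewrite divr_gt0. Qed.

Let tau_cvg w : tau_ m w @[m --> \oo] --> tau w.
Proof.
apply: passage_grid_cvg => //; first exact: continuous_drifted.
by move=> m k _; exact: walk_grid_step.
Qed.

Let tau_ge0 m w : 0 <= tau_ m w.
Proof. by rewrite mulr_ge0 ?ler0n// ltW. Qed.

(** Inherited from the grid passage times, of which [tau] is the pointwise limit. *)
Lemma measurable_drifted_passage_time : measurable_fun setT (fun w => tau w).
Proof.
apply: (@measurable_fun_cvg _ _ _ _ tau_) => [m|w _]; last exact: tau_cvg.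
apply: (measurable_passage_comp _ _ _ _ (fun i _ => i%:R * (N / m.+1%:R))) => //.
by move=> i _; exact: measurable_grid_step.
Qed.

Let Z (c : R) m w := expR (c * drifted (tau_ m w) w - (c ^+ 2 - mu * c) * tau_ m w).

Let ZE c m w : Z c m w =
  expwalk (step m) c ((c ^+ 2 - mu * c) * (N / m.+1%:R)) (passage (step m) x m.+1 w) w.
Proof.
by rewrite /Z /expwalk walk_grid_step; congr (expR (_ - _)); rewrite /tau_; ring.
Qed.

Let measurable_Z c m : measurable_fun setT (Z c m).
Proof.
rewrite (funext (ZE c m)).
apply: measurable_passage_comp; first by move=> i _; exact: measurable_grid_step.
by move=> i _; apply: measurable_expwalk => j _; exact: measurable_grid_step.
Qed.

Let integral_Z c m : (\int[P]_w (Z c m w)%:E = 1)%E.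
Proof.
under eq_integral do rewrite ZE.
apply: integral_stopped_expwalk.
- exact: measurable_grid_step.
- exact: indep_grid_step.
- exact: integral_exp_grid_step.
Qed.

Lemma integral_exp_passage_time (c : R) :
  (\int[P]_w (expR (c * drifted (tau w) w - (c ^+ 2 - mu * c) * tau w))%:E = 1)%E.
Proof.
apply: (@integral_cvg_L2_bounded _ _ _ _ (Z c) _ (expR (2 * c ^+ 2 * N))).
- exact: measurable_Z.
- by move=> m w; exact: expR_ge0.
- move=> w; apply: continuous_cvg; first exact: continuous_expR.
  apply: cvgB; apply: cvgM; do ?exact: cvg_cst; last exact: tau_cvg.
  apply: (path_cvg_comp _ (continuous_drifted w)) => //.
  by apply: passage_time_ge0; exact: ltW.
- exact: integral_Z.
(* the square of the martingale with parameter [c] is dominated by a multiple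
   of the one with parameter [2 * c] *)
move=> m.
apply: (@le_trans _ _ (\int[P]_w (expR (2 * c ^+ 2 * N) * Z (2 * c) m w)%:E)%E).
  apply: le_integral_EFin.
  - exact: measurable_funX.
  - by apply: measurable_funM.
  - by move=> w; exact: sqr_ge0.
  move=> w; rewrite /Z -expRM_natl -expRD ler_expR.
  have tN : tau_ m w <= N.
    rewrite /tau_ mulrA ler_pdivrMr// mulrC ler_pM2l// ler_nat.
    exact: passage_le.
  (* The exponent of the square at [c] minus the exponent at [2 * c] is exactly
     [2 * c ^+ 2 * tau_ m w]: the path and drift terms cancel. *)
  have : 2 * c ^+ 2 * tau_ m w <= 2 * c ^+ 2 * N.
    by rewrite ler_wpM2l// mulr_ge0// sqr_ge0.
  rewrite -subr_ge0 => H; rewrite -subr_ge0.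
  by apply: le_trans H _; rewrite le_eqVlt; apply/orP; left; apply/eqP; ring.
rewrite ge0_integralZl_R ?expR_ge0//; last by move=> w; exact: expR_ge0.
by rewrite integral_Z mule1.
Qed.

Variables (lam : R).
Hypotheses (mu0 : 0 <= mu) (lam0 : 0 < lam).

Let th := mu / 2 + Num.sqrt (lam + (mu / 2) ^+ 2).

Let th_lam : th ^+ 2 - mu * th = lam.
Proof.
rewrite /th; set r := Num.sqrt _.
have r2 : r ^+ 2 = lam + (mu / 2) ^+ 2.
  by rewrite sqr_sqrtr// addr_ge0 ?(ltW lam0)// sqr_ge0.
transitivity (r ^+ 2 - (mu / 2) ^+ 2); first by field.
by rewrite r2 addrK.
Qed.

Let th0 : 0 <= th.
Proof. by rewrite addr_ge0 ?divr_ge0// sqrtr_ge0. Qed.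

(** The martingale at [tau] has mean 1. The path is at most [x] there, which gives the lower bound.
    It is at least [x] when [tau < N]; otherwise [expR (- (lam * tau w))] is at most the error
    term. *)
Lemma laplace_passage_time :
  ((expR (- (th * x)))%:E <= \int[P]_w (expR (- (lam * tau w)))%:E <=
   (expR (- (th * x)))%:E + (expR (- (lam * N)))%:E)%E.
Proof.
have := integral_exp_passage_time th; rewrite th_lam => mart.
have mtau := measurable_drifted_passage_time.
have mE : measurable_fun setT (fun w => expR (- (lam * tau w))).
  apply: measurableT_comp => //; apply: measurableT_comp => //.
  exact: measurable_funM.
have mX : measurable_fun setT (fun w => expR (th * drifted (tau w) w - lam * tau w)).
  rewrite -th_lam.
  apply: (@measurable_fun_cvg _ _ _ _ (Z th)) => [m|w _]; first exact: measurable_Z.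
  apply: continuous_cvg; first exact: continuous_expR.
  apply: cvgB; apply: cvgM; do ?exact: cvg_cst; last exact: tau_cvg.
  apply: (path_cvg_comp _ (continuous_drifted w)) => //.
  by apply: passage_time_ge0; exact: ltW.
have E0 w : 0 <= expR (- (lam * tau w)) by exact: expR_ge0.
have X0 w : 0 <= expR (th * drifted (tau w) w - lam * tau w) by exact: expR_ge0.
apply/andP; split.
  rewrite -[X in (X <= _)%E]mule1 -mart -ge0_integralZl_R ?expR_ge0//.
  apply: le_integral_EFin => //; first exact: measurable_funM.
  move=> w; rewrite -expRD ler_expR addrA gerDr addrC subr_le0.
  apply: ler_wpM2l => //; apply: (path_passage_time_le _ (continuous_drifted w)).
  - exact: ltW.
  - by rewrite drifted0.
rewrite -[X in (_ <= X + _)%E]mule1 -mart -ge0_integralZl_R ?expR_ge0//.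
rewrite -[X in (_ <= _ + X)%E]mule1 -(probability_setT P) -integral_cst//.
pose G w := expR (- (th * x)) * expR (th * drifted (tau w) w - lam * tau w).
have mG : measurable_fun setT G by exact: measurable_funM.
have G0 w : 0 <= G w by rewrite mulr_ge0 ?expR_ge0.
rewrite -(ge0_integralD_EFin P G (cst (expR (- (lam * N)))) mG)//; last first.
  by move=> w; exact: expR_ge0.
apply: le_integral_EFin => //.
  exact: measurable_funD.
move=> w; rewrite /G /=.
have [tN|tN] := ltP (tau w) N.
  rewrite -[leLHS]addr0 lerD ?expR_ge0// -expRD ler_expR addrA lerDr addrC subr_ge0.
  apply: ler_wpM2l => //; apply: (path_passage_time_ge _ (continuous_drifted w)) => //.
  exact: ltW.
rewrite -[leLHS]add0r lerD ?mulr_ge0 ?expR_ge0//.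
by rewrite ler_expR lerN2 ler_pM2l.
Qed.

End drifted_brownian.

(** * Polynomials approximating the indicator of a half-line *)

Section threshold_polynomial.
Context {R : realType}.
Implicit Types (u r s v : R) (n K : nat).

(* On [0, 1] this tends to the indicator of [u > 1/2] off [u = 1/2], and it has
   no constant term, so that it only involves Laplace transforms at positive
   arguments. *)
Definition threshold n : {poly R} := 1 - (1 - 'X^n) ^+ (2 ^ n).

Lemma threshold_horner n u : (threshold n).[u] = 1 - (1 - u ^+ n) ^+ (2 ^ n).
Proof. by rewrite /threshold !hornerE. Qed.

Lemma threshold_coef0 n : (0 < n)%N -> (threshold n)`_0 = 0.
Proof.
move=> n0; rewrite -horner_coef0 threshold_horner expr0n gtn_eqF//.
by rewrite subr0 expr1n subrr.
Qed.

Lemma bernoulli_le v K : 0 <= v <= 1 -> 1 - K%:R * v <= (1 - v) ^+ K.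
Proof.
move=> /andP[v0 v1]; elim: K => [|K ih]; first by rewrite mul0r subr0 expr0.
rewrite exprS; apply: (@le_trans _ _ ((1 - v) * (1 - K%:R * v))).
  rewrite -subr_ge0 -natr1.
  rewrite (_ : _ - _ = K%:R * v ^+ 2); first by rewrite mulr_ge0// sqr_ge0.
  by ring.
by rewrite ler_wpM2l// subr_ge0.
Qed.

(** Bernoulli bounds the polynomial by [2 ^ n * u ^+ n]; the bound tends to 0 when [s < 1/2]. *)
Lemma threshold_le n u s : 0 <= u <= 1 -> u <= s ->
  (threshold n).[u] <= (2 * s) ^+ n.
Proof.
move=> /andP[u0 u1] us; rewrite threshold_horner lerBlDl.
have un : 0 <= u ^+ n <= 1 by rewrite exprn_ge0//= exprn_ile1.
rewrite -lerBlDr; apply: le_trans (bernoulli_le _ _ un).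
rewrite lerB// natrX -exprMn.
apply: lerXn2r; rewrite ?nnegrE ?ler_pM2l//; apply: mulr_ge0 => //.
exact: le_trans us.
Qed.

(** With [v = u ^+ n] and [K = 2 ^ n], [(1 - v) ^+ K <= expR (- (K * v)) <= (K * v)^-1]; the error
    tends to 0 when [r > 1/2]. *)
Lemma threshold_ge n u r : 0 < r -> r <= u <= 1 ->
  1 - ((2 * r)^-1) ^+ n <= (threshold n).[u].
Proof.
move=> r0 /andP[ru u1]; rewrite threshold_horner lerB//.
have u0 : 0 < u := lt_le_trans r0 ru.
have un0 : 0 < u ^+ n by rewrite exprn_gt0.
have un1 : u ^+ n <= 1 by rewrite exprn_ile1// ltW.
apply: (@le_trans _ _ (expR (- (2 ^ n)%:R * u ^+ n))).
  rewrite mulNr -mulrN expRM_natl lerXn2r ?nnegrE ?expR_ge0 ?subr_ge0//.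
  exact: expR_ge1Dx.
rewrite mulNr expRN exprVn lef_pV2 ?posrE ?expR_gt0 ?exprn_gt0 ?mulr_gt0//.
apply: le_trans (expR_ge1Dx _).
apply: (@le_trans _ _ ((2 ^ n)%:R * u ^+ n)); last by rewrite lerDr.
rewrite natrX -exprMn lerXn2r ?nnegrE ?mulr_ge0 ?(ltW r0) ?(ltW u0)//.
by rewrite ler_pM2l.
Qed.

Lemma threshold_itv n u : 0 <= u <= 1 -> 0 <= (threshold n).[u] <= 1.
Proof.
move=> /andP[u0 u1]; rewrite threshold_horner.
have /andP[a0 a1] : 0 <= 1 - u ^+ n <= 1.
  by rewrite subr_ge0 exprn_ile1//= lerBlDr lerDl exprn_ge0.
by rewrite subr_ge0 exprn_ile1//= lerBlDr lerDl exprn_ge0.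
Qed.

End threshold_polynomial.

(** * Expectations of polynomials in a variable with values in the unit interval *)

Section moments.
Context {R : realType} {d : measure_display} {Omega : measurableType d}.
Variable P : probability Omega R.

Lemma bounded01_integrable (f : Omega -> R) : measurable_fun setT f ->
  (forall w, 0 <= f w <= 1) -> P.-integrable setT (EFin \o f).
Proof.
move=> mf f01; apply: measurable_bounded_integrable => //.
  exact: le_lt_trans (probability_le1 P measurableT) (ltry _).
exists 1; split => // M M1 w _; have /andP[f0 f1] := f01 w.
by rewrite /= ger0_norm// (le_trans f1)// ltW.
Qed.

Lemma Rintegral_indic_prob (A : set Omega) : measurable A ->
  \int[P]_w (\1_A w : R) = fine (P A).
Proof. by move=> mA; rewrite /Rintegral integral_indic// setIT. Qed.

Variable U : Omega -> R.
Hypotheses (mU : measurable_fun setT U) (U01 : forall w, 0 <= U w <= 1).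

Lemma power01_integrable i : P.-integrable setT (EFin \o (fun w => U w ^+ i)).
Proof.
apply: bounded01_integrable; first exact: measurable_funX.
by move=> w; have /andP[? ?] := U01 w; rewrite exprn_ge0//= exprn_ile1.
Qed.

Lemma Rintegral_power_sum (c : nat -> R) n :
  P.-integrable setT (EFin \o (fun w => \sum_(i < n) c i * U w ^+ i)) /\
  \int[P]_w (\sum_(i < n) c i * U w ^+ i) =
    \sum_(i < n) c i * \int[P]_w (U w ^+ i).
Proof.
elim: n => [|n [ihi ih]].
  split.
    rewrite (_ : _ \o _ = cst 0%E); first exact: integrable0.
    by apply/funext => w /=; rewrite big_ord0.
  under eq_Rintegral do rewrite big_ord0.
  by rewrite big_ord0 Rintegral_cst// mul0r.
have iU : P.-integrable setT (EFin \o (fun w => c n * U w ^+ n)).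
  exact: (integrableZl measurableT (c n) (power01_integrable n)).
split.
  apply: eq_integrable (integrableD measurableT ihi iU) => // w _.
  by rewrite /= big_ord_recr.
under eq_Rintegral do rewrite big_ord_recr/=.
rewrite RintegralD// ih big_ord_recr/= RintegralZl//.
exact: power01_integrable.
Qed.

Lemma Rintegral_horner (p : {poly R}) :
  \int[P]_w p.[U w] = \sum_(i < size p) p`_i * \int[P]_w (U w ^+ i).
Proof.
under eq_Rintegral do rewrite horner_coef.
by rewrite (Rintegral_power_sum (fun i => p`_i) _).2.
Qed.

Lemma measurable_horner_comp (p : {poly R}) : measurable_fun setT (fun w => p.[U w]).
Proof.
have [/(measurable_int P)/measurable_EFinP + _] :=
  Rintegral_power_sum (fun i => p`_i) (size p).
by under eq_fun do rewrite -horner_coef.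
Qed.

Lemma threshold_integrable n :
  P.-integrable setT (EFin \o (fun w => (threshold n).[U w])).
Proof.
apply: bounded01_integrable; first exact: measurable_horner_comp.
by move=> w; exact: threshold_itv.
Qed.

Let mUge r : measurable [set w | r <= U w].
Proof.
rewrite (_ : mkset _ = U @^-1` `[r, +oo[).
  by rewrite -[X in measurable X]setTI; exact: mU.
by apply/seteqP; split => w /=; rewrite in_itv/= andbT.
Qed.

Lemma le_Rintegral_threshold n r : 0 < r ->
  (1 - ((2 * r)^-1) ^+ n) * fine (P [set w | r <= U w]) <=
  \int[P]_w (threshold n).[U w].
Proof.
move=> r0; rewrite -Rintegral_indic_prob// -RintegralZl//; last first.
  exact: integrable_indic.
apply: le_Rintegral => //.
- apply: (integrableZl measurableT (1 - (2 * r)^-1 ^+ n)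
    (f := EFin \o (\1_[set w | r <= U w] : Omega -> R))).
  exact: integrable_indic.
- exact: threshold_integrable.
move=> w _; rewrite indicE.
have [|_] := boolP (w \in _).
  by rewrite inE /= mulr1 => rU; apply: threshold_ge => //; rewrite rU; case/andP: (U01 w).
by rewrite mulr0; case/andP: (threshold_itv n (U w) (U01 w)).
Qed.

Lemma ge_Rintegral_threshold n s : 0 <= s ->
  \int[P]_w (threshold n).[U w] <=
  fine (P [set w | s <= U w]) + (2 * s) ^+ n.
Proof.
move=> s0; rewrite -Rintegral_indic_prob//.
rewrite -[X in _ <= _ + X]mulr1 -[X in _ <= _ + _ * X]/(fine 1%E) -(probability_setT P).
rewrite -Rintegral_cst// -RintegralD//; last 2 first.
- exact: integrable_indic.
- exact: finite_measure_integrable_cst.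
apply: le_Rintegral => //.
- exact: threshold_integrable.
- exact: (integrableD measurableT (integrable_indic P (mUge s))
    (finite_measure_integrable_cst P ((2 * s) ^+ n) measurableT)).
move=> w _; rewrite indicE.
have [_|] := boolP (w \in _).
  rewrite (@le_trans _ _ 1)//; first by case/andP: (threshold_itv n (U w) (U01 w)).
  by rewrite lerDl exprn_ge0// mulr_ge0.
rewrite notin_setE /= add0r => /negP; rewrite -ltNge => /ltW Us.
exact: threshold_le.
Qed.

End moments.

(** * Comparing distribution functions through Laplace transforms *)

Section laplace_comparison.
Context {R : realType} {d1 d2 : measure_display}.
Context {Omega1 : measurableType d1} {Omega2 : measurableType d2}.
Variables (P1 : probability Omega1 R) (P2 : probability Omega2 R).

(** The threshold polynomial is integrated on both sides. For fixed [n], letting [N] grow cancels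
    the moments; letting [n] grow afterwards removes the errors [(2 * r)^-1 ^+ n] and
    [(2 * s) ^+ n], because [s < 1/2 < r]. *)
Lemma moment_comparison (U : nat -> Omega1 -> R) (V : nat -> Omega2 -> R)
    (a1 a2 r s p q : R) :
  (forall N, measurable_fun setT (U N)) -> (forall N w, 0 <= U N w <= 1) ->
  (forall N, measurable_fun setT (V N)) -> (forall N w, 0 <= V N w <= 1) ->
  0 <= a1 -> 0 <= a2 -> 2^-1 < r -> 0 <= s -> s < 2^-1 ->
  (forall i, (0 < i)%N ->
    a1 * \int[P1]_w (U N w ^+ i) - a2 * \int[P2]_w (V N w ^+ i)
      @[N --> \oo] --> (0 : R)) ->
  (forall N, p <= a1 * fine (P1 [set w | r <= U N w])) ->
  (forall N, a2 * fine (P2 [set w | s <= V N w]) <= q) ->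
  p <= q.
Proof.
move=> mU U01 mV V01 a10 a20 hr s0 hs mom pU qV.
have r0 : 0 < r by rewrite (lt_trans _ hr).
have r20 : 0 < 2 * r by rewrite mulr_gt0.
have r2 : (2 * r)^-1 < 1.
  by rewrite invf_lt1// mulrC -ltr_pdivrMr// div1r.
have s2 : 2 * s < 1 by rewrite mulrC -ltr_pdivlMr// div1r.
have step n : (0 < n)%N -> p * (1 - (2 * r)^-1 ^+ n) <= q + a2 * (2 * s) ^+ n.
  move=> n0.
  have cvg : a1 * \int[P1]_w (threshold n).[U N w] -
      a2 * \int[P2]_w (threshold n).[V N w] @[N --> \oo] --> (0 : R).
    suff : \sum_(i < size (@threshold R n))
        ((threshold n)`_i * (a1 * \int[P1]_w (U N w ^+ i) -
                             a2 * \int[P2]_w (V N w ^+ i))) @[N --> \oo] -->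
        \sum_(i < size (@threshold R n)) (0 : R).
      rewrite big1_eq; apply: cvg_trans.
      apply: near_eq_cvg; apply: nearW => N.
      rewrite !Rintegral_horner// !mulr_sumr -sumrB.
      by apply: eq_bigr => i _; rewrite mulrBr mulrCA [X in _ - X]mulrCA.
    apply: cvg_big => [|i _]; first exact: add_continuous.
    (* The zeroth moments need not match; the vanishing constant coefficient discards them. *)
    have [i0|i0] := posnP i.
      by rewrite i0 threshold_coef0//; under eq_fun do rewrite mul0r; exact: cvg_cst.
    rewrite -[X in _ --> X](mulr0 (threshold n)`_i).
    by apply: cvgM; [exact: cvg_cst|exact: mom].
  suff : p * (1 - (2 * r)^-1 ^+ n) - (q + a2 * (2 * s) ^+ n) <= 0 by rewrite subr_le0.
  apply: (ler_cvg_to (cvg_cst _) cvg); apply: nearW => N.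
  apply: lerB.
    apply: (@le_trans _ _ (a1 * ((1 - ((2 * r)^-1) ^+ n) * fine (P1 [set w | r <= U N w])))).
      rewrite mulrCA mulrC ler_wpM2l// subr_ge0 exprn_ile1 ?invr_ge0 ?ltW//.
    by rewrite ler_wpM2l// le_Rintegral_threshold.
  apply: (@le_trans _ _ (a2 * (fine (P2 [set w | s <= V N w]) + (2 * s) ^+ n))).
    by rewrite ler_wpM2l// ge_Rintegral_threshold.
  by rewrite mulrDr lerD2r.
have cl : p * (1 - (2 * r)^-1 ^+ n) @[n --> \oo] --> p.
  rewrite -[X in _ --> X]mulr1 -[X in _ --> p * X]subr0.
  apply: cvgM; first exact: cvg_cst.
  apply: cvgB; first exact: cvg_cst.
  by apply: cvg_expr; rewrite gtr0_norm ?invr_gt0.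
have cr : q + a2 * (2 * s) ^+ n @[n --> \oo] --> q.
  rewrite -[X in _ --> X]addr0 -[X in _ --> q + X](mulr0 a2).
  apply: cvgD; first exact: cvg_cst.
  apply: cvgM; first exact: cvg_cst.
  by apply: cvg_expr; rewrite ger0_norm ?mulr_ge0.
by apply: (ler_cvg_to cl cr); exists 1%N.
Qed.

(** Under [y |-> expR (- (c * y))], Laplace transforms at multiples of [c] become moments, and small
    times become values close to 1. *)
Lemma laplace_comparison (Y : nat -> Omega1 -> R) (Z : nat -> Omega2 -> R)
    (a1 a2 t1 t2 p q : R) :
  (forall N, measurable_fun setT (Y N)) -> (forall N w, 0 <= Y N w) ->
  (forall N, measurable_fun setT (Z N)) -> (forall N w, 0 <= Z N w) ->
  0 <= a1 -> 0 <= a2 -> 0 < t1 -> t1 < t2 ->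
  (forall lam, 0 < lam ->
    a1 * \int[P1]_w expR (- (lam * Y N w)) -
    a2 * \int[P2]_w expR (- (lam * Z N w)) @[N --> \oo] --> (0 : R)) ->
  (forall N, p <= a1 * fine (P1 [set w | Y N w <= t1])) ->
  (forall N, a2 * fine (P2 [set w | Z N w <= t2]) <= q) ->
  p <= q.
Proof.
move=> mY Y0 mZ Z0 a10 a20 t10 t12 lap pY qZ.
pose t := (t1 + t2) / 2.
have tt1 : t1 < t by rewrite midf_lt.
have tt2 : t < t2 by rewrite midf_lt.
have t0 : 0 < t by rewrite (lt_trans t10).
have ln20 : 0 < ln (2 : R) by rewrite ln_gt0// ltr1n.
(* This scale sends the midpoint [t] of [t1] and [t2] to the threshold [1/2], so that their images
   lie strictly on either side of it. *)
pose c := ln 2 / t.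
have c0 : 0 < c by rewrite divr_gt0.
have half : expR (- (c * t)) = 2^-1.
  by rewrite /c divfK ?gt_eqF// expRN lnK// posrE.
have itv (y : R) : 0 <= y -> 0 <= expR (- (c * y)) <= 1.
  by move=> y0; rewrite expR_ge0/= -expR0 ler_expR oppr_le0 mulr_ge0// ltW.
have mexp d (T : measurableType d) (f : T -> R) : measurable_fun setT f ->
    measurable_fun setT (fun w => expR (- (c * f w))).
  move=> mf; apply: measurableT_comp => //; apply: measurableT_comp => //.
  exact: measurable_funM.
apply: (moment_comparison (fun N w => expR (- (c * Y N w)))
  (fun N w => expR (- (c * Z N w))) a1 a2 (expR (- (c * t1))) (expR (- (c * t2)))) => //.
- by move=> N; exact: mexp.
- by move=> N w; exact: itv.
- by move=> N; exact: mexp.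
- by move=> N w; exact: itv.
- by rewrite -half ltr_expR ltrN2 ltr_pM2l.
- by rewrite -half ltr_expR ltrN2 ltr_pM2l.
- move=> i i0.
  under eq_fun do under eq_Rintegral do rewrite -expRM_natl mulrN mulrA.
  under eq_fun do under [X in _ * _ - _ * X]eq_Rintegral do rewrite -expRM_natl mulrN mulrA.
  by apply: lap; rewrite mulr_gt0// ltr0n.
- move=> N; under eq_set do rewrite ler_expR lerN2 ler_pM2l//.
  exact: pY.
- move=> N; under eq_set do rewrite ler_expR lerN2 ler_pM2l//.
  exact: qZ.
Qed.

End laplace_comparison.

(** * Measurability criteria and one-sided continuity of distribution functions *)

Section probability_lemmas.
Context {R : realType} {d : measure_display} {Omega : measurableType d}.
Variable P : probability Omega R.

Lemma fine_prob_le (A C : set Omega) : measurable A -> measurable C ->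
  A `<=` C -> fine (P A) <= fine (P C).
Proof.
move=> mA mC AC; apply: fine_le; do ?exact: fin_num_measure.
by apply: le_measure => //; rewrite inE.
Qed.

Lemma measurable_fun_gtP (f : Omega -> R) :
  (forall y, measurable [set w | y < f w]) -> measurable_fun setT f.
Proof.
move=> H; apply: (measurability _ (RGenOInfty.measurableE R)).
move=> _ [_ [y ->] <-]; rewrite setTI.
rewrite (_ : _ @^-1` _ = [set w | y < f w])//.
by apply/seteqP; split => w /=; rewrite in_itv/= andbT.
Qed.

Lemma measurable_fun_geP (f : Omega -> R) :
  (forall y, measurable [set w | y <= f w]) -> measurable_fun setT f.
Proof.
move=> H; apply: (measurability _ (RGenCInfty.measurableE R)).
move=> _ [_ [y ->] <-]; rewrite setTI.
rewrite (_ : _ @^-1` _ = [set w | y <= f w])//.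
by apply/seteqP; split => w /=; rewrite in_itv/= andbT.
Qed.

Variable X : Omega -> R.
Hypothesis mX : measurable_fun setT X.

Lemma measurable_le_set t : measurable [set w | X w <= t].
Proof.
rewrite (_ : mkset _ = X @^-1` `]-oo, t]).
  by rewrite -[_ @^-1` _]setTI; exact: mX.
by apply/seteqP; split => w /=; rewrite in_itv.
Qed.

Lemma measurable_ge_set t : measurable [set w | t <= X w].
Proof.
rewrite (_ : mkset _ = X @^-1` `[t, +oo[).
  by rewrite -[_ @^-1` _]setTI; exact: mX.
by apply/seteqP; split => w /=; rewrite in_itv/= andbT.
Qed.

Lemma measurable_gt_set t : measurable [set w | t < X w].
Proof.
rewrite (_ : mkset _ = X @^-1` `]t, +oo[).
  by rewrite -[_ @^-1` _]setTI; exact: mX.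
by apply/seteqP; split => w /=; rewrite in_itv/= andbT.
Qed.

(** Right continuity of the distribution function, in the form that removes the gap between the two
    times of [laplace_comparison]. *)
Lemma prob_le_right_lim (t e c a : R) : 0 < e ->
  (forall u, t < u < t + e -> c <= a * fine (P [set w | X w <= u])) ->
  c <= a * fine (P [set w | X w <= t]).
Proof.
(* The shift by 2 keeps [u 0] strictly below [t + e]. *)
move=> e0 H; pose u (n : nat) := t + e / n.+2%:R.
have tu n : t < u n < t + e.
  rewrite ltrDl divr_gt0//= ltrD2l ltr_pdivrMr// ltr_pMr//.
  by rewrite ltr1n.
have cvgP : P [set w | X w <= u n] @[n --> \oo] --> P [set w | X w <= t].
  rewrite (_ : [set w | X w <= t] = \bigcap_n [set w | X w <= u n]).
    apply: nonincreasing_cvg_mu => //.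
    - by rewrite (le_lt_trans (probability_le1 P _) (ltry 1))//; exact: measurable_le_set.
    - by move=> n; exact: measurable_le_set.
    - by apply: bigcapT_measurable => n; exact: measurable_le_set.
    - move=> m n mn; apply/subsetPset => w /= /le_trans; apply.
      by rewrite lerD2l ler_pM2l// lef_pV2 ?posrE// ler_nat !ltnS.
  apply/seteqP; split => w /=.
    by move=> Xt n _ /=; rewrite (le_trans Xt)//; case/andP: (tu n) => /ltW.
  move=> Xu; rewrite leNgt; apply/negP => tX.
  have tX0 : 0 < X w - t by rewrite subr_gt0.
  have := Xu (Num.truncn (e / (X w - t))) I => /=; apply/negP; rewrite -ltNge.
  rewrite /u -ltrBrDl ltr_pdivrMr// mulrC -ltr_pdivrMr//.
  apply: lt_le_trans (truncnS_gt _) _; by rewrite ler_nat.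
have cf : a * fine (P [set w | X w <= u n]) @[n --> \oo] -->
    a * fine (P [set w | X w <= t]).
  apply: cvgM; first exact: cvg_cst.
  by apply: fine_cvg; rewrite fineK// fin_num_measure//; exact: measurable_le_set.
by apply: (ler_cvg_to (cvg_cst c) cf); apply: nearW => n; exact: H.
Qed.

End probability_lemmas.

(** Closed upper rays form a pi-system generating the Borel sets, and the rays from [- n] exhaust
    the line. *)
Lemma eq_distribution_ge {R : realType} {d1 d2 : measure_display}
    {Omega1 : measurableType d1} {Omega2 : measurableType d2}
    (P1 : probability Omega1 R) (P2 : probability Omega2 R)
    (X : Omega1 -> R) (Y : Omega2 -> R) :
  measurable_fun setT X -> measurable_fun setT Y ->
  (forall x, P1 [set w | x <= X w] = P2 [set w | x <= Y w]) ->
  forall A, measurable A -> P1 (X @^-1` A) = P2 (Y @^-1` A).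
Proof.
move=> mX mY XY A mA.
pose X' : {RV P1 >-> R} := mfun_Sub (mem_set mX).
pose Y' : {RV P2 >-> R} := mfun_Sub (mem_set mY).
have rayE (T : Type) (f : T -> R) x :
    f @^-1` `[x, +oo[%classic = [set w | x <= f w].
  by apply/seteqP; split => w /=; rewrite in_itv/= andbT.
apply: (measure_unique (@RGenCInfty.G R) (fun n => `[- n%:R, +oo[%classic)
  _ _ _ _ (distribution P1 X') (distribution P2 Y')) => //.
- exact: RGenCInfty.measurableE.
- move=> _ _ [x ->] [y ->]; exists (Num.max x y).
  by apply/seteqP; split => z /=; rewrite !in_itv/= !andbT ge_max => /andP.
- by move=> n; exists (- n%:R).
- apply/seteqP; split => // z _; exists (Num.truncn (- z)).+1 => //=.
  by rewrite in_itv/= andbT lerNl ltW// truncnS_gt.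
- by move=> _ [x ->]; rewrite /= /distribution /pushforward !rayE.
- by move=> n; rewrite (le_lt_trans (probability_le1 _ _) (ltry 1)).
Qed.

(** * The running maximum compared with the subordinator at a fixed level *)

Section maximum_versus_subordinator.
Context {R : realType} {d1 d2 : measure_display}.
Context {Omega1 : measurableType d1} {Omega2 : measurableType d2}.
Variables (P1 : probability Omega1 R) (P2 : probability Omega2 R).
Variables (mu : R) (B : R -> Omega1 -> R) (H : R -> Omega2 -> R).
Hypothesis mu_gt0 : 0 < mu.
Hypothesis hB : std_brownian_motion P1 B.
Hypothesis hH : subordinator P2 H (relativistic_exponent ((mu / 2) ^+ 2)).

Local Notation X := (drifted mu B).

(** By continuity, a level exceeded on [[0, t]] is exceeded at a point of some grid, which makes the
    event a countable union. *)
Lemma measurable_running_max t : 0 < t ->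
  measurable_fun setT (running_max X t).
Proof.
move=> t0; apply: measurable_fun_gtP => y.
rewrite (_ : mkset _ = \bigcup_m \bigcup_(k in [set k | (k <= m.+1)%N])
    [set w | y < X (k%:R * (t / m.+1%:R)) w]).
  apply: bigcupT_measurable => m; apply: bigcup_measurable => k _.
  by apply: measurable_gt_set; exact: (measurable_drifted P1 mu B hB).
apply/seteqP; split => w /=.
  move=> /(running_max_gtP _ (continuous_drifted P1 mu B hB w) _ _ t0)[s [st ys]].
  have [m0 /(_ _ (leqnn _))[k [km _ yk]]] := grid_approx _
    (continuous_drifted P1 mu B hB w) y t s 1 t0 st ys ltr01.
  by exists m0 => //; exists k.
move=> [m _ [k /= km yk]].
apply/(running_max_gtP _ (continuous_drifted P1 mu B hB w) _ _ t0).
exists (k%:R * (t / m.+1%:R)); split => //.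
rewrite mulr_ge0 ?divr_ge0 ?(ltW t0)//= mulrA ler_pdivrMr// mulrC.
by rewrite ler_pM2l// ler_nat.
Qed.

Lemma running_max_ge0 t w : 0 < t -> 0 <= running_max X t w.
Proof.
move=> t0; have hs := path_bounded _ (continuous_drifted P1 mu B hB w) t (ltW t0).
rewrite /running_max -[leLHS](drifted0 P1 mu B hB w); apply: (ub_le_sup hs.2).
by exists 0; rewrite lexx ltW.
Qed.

Lemma subordinator_ge0 s w : 0 <= s -> 0 <= H s w.
Proof. by case: hH => H0 [_ [nd _]] s0; rewrite -(H0 w); exact: nd. Qed.

Lemma subordinator_measurable s : measurable_fun setT (H s).
Proof. by case: hH => _ []. Qed.

Lemma subordinator_laplace lam s : 0 <= lam -> 0 <= s ->
  \int[P2]_w expR (- (lam * H s w)) =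
  expR (- (s * relativistic_exponent ((mu / 2) ^+ 2) lam)).
Proof.
case: hH => _ [_ [_ [_ [_ [_ lap]]]]] lam0 s0.
by rewrite /Rintegral; have := lap _ _ lam0 s0; rewrite unlock => ->.
Qed.

Variables (x t : R).
Hypotheses (x0 : 0 < x) (t0 : 0 < t).

(** All horizons are at least [t + 1], so the cap is not felt at times below [t + 1]; it disappears
    as [n] grows. *)
Let tau (n : nat) w := passage_time (fun s => X s w) x (t + n.+1%:R).

Let N0 n : 0 < t + n.+1%:R. Proof. by rewrite addr_gt0. Qed.

Let mtau n : measurable_fun setT (tau n).
Proof. exact: (measurable_drifted_passage_time P1 mu B hB). Qed.

Let tau_ge0 n w : 0 <= tau n w.
Proof. exact/passage_time_ge0/ltW. Qed.

Let iexp (d : measure_display) (T : measurableType d) (P : probability T R)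
    (f : T -> R) : measurable_fun setT f -> (forall w, 0 <= f w) ->
  P.-integrable setT (EFin \o (fun w => expR (- f w))).
Proof.
move=> mf f0; apply: bounded01_integrable.
  by do 2 apply: measurableT_comp => //.
by move=> w; rewrite expR_ge0/= -expR0 ler_expR oppr_le0.
Qed.

Let laplace_cvg lam : 0 < lam ->
  \int[P1]_w expR (- (lam * tau n w)) -
  expR (- (mu * x)) * \int[P2]_w expR (- (lam * H x w)) @[n --> \oo] --> (0 : R).
Proof.
move=> lam0; set E := expR (- (mu * x)) * _.
pose th := mu / 2 + Num.sqrt (lam + (mu / 2) ^+ 2).
(* The square root of [(mu / 2) ^+ 2] is [mu / 2], so [th] is [mu] plus the relativistic exponent at
   [lam]. *)
have EE : E = expR (- (th * x)).
  rewrite /E subordinator_laplace ?(ltW lam0) ?(ltW x0)// -expRD; congr expR.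
  rewrite /relativistic_exponent sqrtr_sqr ger0_norm ?divr_ge0 ?(ltW mu_gt0)//.
  by rewrite /th; field.
have bnd n : 0 <= \int[P1]_w expR (- (lam * tau n w)) - E <= expR (- lam) ^+ n.
  have /andP[lo hi] := laplace_passage_time P1 mu B hB x (t + n.+1%:R) (ltW x0)
    (N0 n) lam (ltW mu_gt0) lam0.
  have fn : (\int[P1]_w (expR (- (lam * tau n w)))%:E)%E \is a fin_num.
    apply: integrable_fin_num => //; apply: iexp.
      exact: measurable_funM.
    by move=> w; rewrite mulr_ge0// ltW.
  move: lo hi; rewrite -/th -EE -(fineK fn) -EFinD !lee_fin => lo hi.
  rewrite subr_ge0 lo/= lerBlDl (le_trans hi)// lerD2l.
  rewrite -expRM_natl ler_expR mulrN lerN2 [leLHS]mulrC ler_pM2l// -natr1 addrA.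
  by rewrite addrAC lerDr addr_ge0// ltW.
apply: (@squeeze_cvgr _ _ _ _ (fun=> 0) (fun n => expR (- lam) ^+ n)).
- exact: nearW.
- exact: cvg_cst.
- by apply: cvg_expr; rewrite ger0_norm ?expR_ge0// -expR0 ltr_expR oppr_lt0.
Qed.

Let max_tau n : [set w | x < running_max X t w] `<=` [set w | tau n w <= t].
Proof.
move=> w /=.
move=> /(running_max_gtP _ (continuous_drifted P1 mu B hB w) _ _ t0)[s [/andP[s0 st] xs]].
apply: (le_trans _ st); apply: passage_time_le => //; first exact: ltW.
by rewrite s0 (le_trans st)// lerDl.
Qed.

Let tau_max : [set w | tau 0 w <= t] `<=` [set w | x <= running_max X t w].
Proof.
move=> w /= tt; have hs := path_bounded _ (continuous_drifted P1 mu B hB w) t (ltW t0).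
have tN : tau 0 w < t + 1%:R by rewrite (le_lt_trans tt)// ltrDl.
have := path_passage_time_ge _ (continuous_drifted P1 mu B hB w) x _ (ltW (N0 0)) tN.
move=> /le_trans; apply; rewrite /running_max.
apply: (ub_le_sup hs.2).
by exists (tau 0 w); rewrite tau_ge0.
Qed.

(** A passage before [t + 1] is seen at every horizon. This bounds the events [tau n <= u] by a
    single one, as the constant [q] of [laplace_comparison] must not depend on [n]. *)
Let tau_horizon n u : u < t + 1 ->
  [set w | tau n w <= u] `<=` [set w | tau 0 w <= u].
Proof.
move=> ut w /= tu; apply: (le_trans _ tu); apply/ler_addgt0Pr => e e0.
have tn : tau n w < t + n.+1%:R.
  by rewrite (le_lt_trans tu)// (lt_le_trans ut)// lerD2l ler1n.
(* The second term of the minimum keeps the exceedance time within the shorter horizon [t + 1]. *)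
have e'0 : 0 < Num.min e (t + 1 - tau n w).
  by rewrite lt_min e0 subr_gt0 (le_lt_trans tu).
have [s [/andP[s0 sN] xs se]] := passage_time_adherent (fun s => X s w) x _
  (ltW (N0 n)) _ e'0 tn.
have st : s <= t + 1.
  by rewrite ltW// (lt_le_trans se)// -lerBrDl ge_min lexx orbT.
apply: (@le_trans _ _ s).
  by apply: passage_time_le => //; [exact: ltW|rewrite s0].
by rewrite ltW// (lt_le_trans se)// lerD2l ge_min lexx.
Qed.

(** The event lies in [tau n <= t] for all [n]; the passage time at [t] is compared with [H x] at
    [u > t], and [u] decreases to [t]. *)
Lemma prob_max_gt_le : fine (P1 [set w | x < running_max X t w]) <=
  expR (- (mu * x)) * fine (P2 [set w | H x w <= t]).
Proof.
have mH := subordinator_measurable x.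
apply: (prob_le_right_lim _ _ mH _ 1) => // u /andP[tu _].
apply: (laplace_comparison P1 P2 tau (fun _ => H x) 1 (expR (- (mu * x))) t u) => //.
- by move=> _ w; exact/subordinator_ge0/ltW.
- by move=> lam lam0; under eq_fun do rewrite mul1r; exact: laplace_cvg.
- move=> n; rewrite mul1r; apply: fine_prob_le (max_tau n).
  + exact/measurable_gt_set/measurable_running_max.
  + exact: measurable_le_set.
Qed.

(** Same comparison with the roles exchanged; taking [u] in a window of length 1 makes [tau_horizon]
    applicable. *)
Lemma prob_max_ge_ge : expR (- (mu * x)) * fine (P2 [set w | H x w <= t]) <=
  fine (P1 [set w | x <= running_max X t w]).
Proof.
have mH := subordinator_measurable x.
apply: (@le_trans _ _ (fine (P1 [set w | tau 0 w <= t]))); last first.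
  apply: fine_prob_le tau_max; first exact: measurable_le_set.
  exact/measurable_ge_set/measurable_running_max.
rewrite -[leRHS]mul1r.
apply: (prob_le_right_lim _ _ (mtau 0) _ 1) => // u /andP[tu ut].
apply: (laplace_comparison P2 P1 (fun _ => H x) tau (expR (- (mu * x))) 1 t u) => //.
- by move=> _ w; exact/subordinator_ge0/ltW.
- move=> lam lam0; under eq_fun do rewrite mul1r -opprB.
  by rewrite -oppr0; apply: cvgN; exact: laplace_cvg.
- move=> n; rewrite !mul1r; apply: fine_prob_le (tau_horizon n u ut);
    exact: measurable_le_set.
Qed.

End maximum_versus_subordinator.

(** * The inverse subordinator and its level sets *)

Section inverse.
Context {R : realType} {d : measure_display} {Omega : measurableType d}.
Variables (P : probability Omega R) (eta : R) (H : R -> Omega -> R).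
Hypothesis eta_ge0 : 0 <= eta.
Hypothesis hH : subordinator P H (relativistic_exponent eta).
Variable t : R.
Hypothesis t0 : 0 < t.

Local Notation L := (inverse_subordinator H t).

Let S w := [set s | 0 < s /\ t < H s w].

Let S_lb w : has_lbound (S w). Proof. by exists 0 => s [/ltW]. Qed.

Let Hnd w s u : 0 <= s -> s <= u -> H s w <= H u w.
Proof. by case: hH => _ [_ [nd _]]; exact: nd. Qed.

Let mH s : measurable_fun setT (H s).
Proof. by case: hH => _ []. Qed.

Lemma inverse_subordinator_ge0 w : 0 <= L w.
Proof.
rewrite /inverse_subordinator -/(S w).
have [[s Ss]|/set0P/negP/negPn/eqP ->] := pselect (S w !=set0); last by rewrite inf0.
by apply: lb_le_inf; [exists s|move=> u [/ltW]].
Qed.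

(** Off this event the infimum defining [L] is over the empty set and equals 0 by convention, not
    infinity; the event is shown to be almost sure below. *)
Definition unbounded_path : set Omega := \bigcup_n [set w | t < H n.+1%:R w].

Lemma unbounded_pathP w : unbounded_path w <-> S w !=set0.
Proof.
split => [[n _ /= tH]|[s [s0 ts]]]; first by exists n.+1%:R.
exists (Num.truncn s) => //=; apply: (lt_le_trans ts); apply: Hnd; first exact: ltW.
by rewrite ltW// truncnS_gt.
Qed.

Lemma measurable_unbounded_path : measurable unbounded_path.
Proof. by apply: bigcupT_measurable => n; exact: measurable_gt_set. Qed.

Lemma le_inverse_subordinator x w : unbounded_path w -> H x w <= t -> x <= L w.
Proof.
move=> /unbounded_pathP S0 Hx; apply: lb_le_inf => // s [s0 ts].
rewrite leNgt; apply/negP => sx.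
by have := lt_le_trans ts (le_trans (Hnd w s x (ltW s0) (ltW sx)) Hx); rewrite ltxx.
Qed.

(** The strict [y < x] matters: [H] may jump over [t] exactly at [x], and then [L w = x] although
    [H x w > t]. *)
Lemma inverse_subordinator_le x y w : 0 < y -> y < x -> x <= L w -> H y w <= t.
Proof.
move=> y0 yx xL; rewrite leNgt; apply/negP => tH.
have : L w <= y by apply: ge_inf; [exact: S_lb|split].
by rewrite leNgt (lt_le_trans yx xL).
Qed.

Lemma inverse_subordinator_gt0_unbounded x w : 0 < x -> x <= L w -> unbounded_path w.
Proof.
move=> x0 xL; apply/unbounded_pathP.
have [//|/set0P/negP/negPn/eqP S0] := pselect (S w !=set0).
by move: xL; rewrite /inverse_subordinator -/(S w) S0 inf0 leNgt x0.
Qed.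

(** For [x > 0], [x <= L] means that [t] is exceeded at some time but at no time before [x]; by
    monotonicity a sequence increasing to [x] suffices. *)
Lemma measurable_inverse_subordinator : measurable_fun setT L.
Proof.
apply: measurable_fun_geP => x.
have [x0|x0] := leP x 0.
  rewrite (_ : mkset _ = setT)//; apply/seteqP; split => // w _ /=.
  exact: le_trans x0 (inverse_subordinator_ge0 w).
(* The shift by 2 keeps [y 0] strictly positive. *)
pose y (n : nat) := x - x / n.+2%:R.
have y0 n : 0 < y n.
  by rewrite subr_gt0 ltr_pdivrMr// ltr_pMr// ltr1n.
have yx n : y n < x by rewrite ltrBlDr ltrDl divr_gt0.
rewrite (_ : mkset _ = unbounded_path `&` \bigcap_n [set w | H (y n) w <= t]).
  apply: measurableI; first exact: measurable_unbounded_path.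
  by apply: bigcapT_measurable => n; exact: measurable_le_set.
apply/seteqP; split => w /=.
  move=> xL; split; first exact: inverse_subordinator_gt0_unbounded xL.
  by move=> n _ /=; exact: inverse_subordinator_le xL.
move=> [/unbounded_pathP S0 Hy]; apply: lb_le_inf => // s [s0 ts].
rewrite leNgt; apply/negP => sx.
have xs0 : 0 < x - s by rewrite subr_gt0.
pose n := Num.truncn (x / (x - s)).
have sy : s <= y n.
  rewrite /y lerBrDr -lerBrDl ler_pdivrMr// mulrC -ler_pdivrMr// ltW//.
  apply: lt_le_trans (truncnS_gt _) _; by rewrite ler_nat.
have := lt_le_trans ts (le_trans (Hnd w s (y n) (ltW s0) sy) (Hy n I)).
by rewrite ltxx.
Qed.

(** Exponential Markov bound with parameter 1: the probability of [H n <= t] is at most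
    [expR (t - n * phi)], with [phi > 0]. *)
Lemma prob_unbounded_path : P (~` unbounded_path) = 0%E.
Proof.
have mU := measurable_unbounded_path.
have mUC : measurable (~` unbounded_path) by exact: measurableC.
pose phi := relativistic_exponent eta 1.
have phi0 : 0 < phi by rewrite subr_gt0 ltr_sqrt ?ltrDr// ltr_wpDr.
have bnd n : fine (P (~` unbounded_path)) <= expR t * expR (- phi) ^+ n.+1.
  rewrite -lee_fin fineK ?fin_num_measure//.
  apply: (@le_trans _ _ (P [set w | H n.+1%:R w <= t])).
    apply: le_measure; rewrite ?inE//; first exact: measurable_le_set.
    by move=> w /= nU; rewrite leNgt; apply/negP => tH; apply: nU; exists n.
  have mA : measurable [set w | H n.+1%:R w <= t] by exact: measurable_le_set.
  rewrite -[X in (P X <= _)%E]setIT -integral_indic//.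
  have mE : measurable_fun setT (fun w => expR (- (1 * H n.+1%:R w))).
    apply: measurableT_comp => //; apply: measurableT_comp => //.
    exact: measurable_funM.
  apply: (@le_trans _ _ (\int[P]_w (expR t * expR (- (1 * H n.+1%:R w)))%:E)%E).
    apply: le_integral_EFin => //.
    - exact: measurable_funM.
    - move=> w; rewrite indicE; have [|_] := boolP (w \in _); last first.
        by rewrite mulr_ge0 ?expR_ge0.
      by rewrite inE/= => Ht; rewrite -expRD mul1r -[leLHS]expR0 ler_expR subr_ge0.
  rewrite ge0_integralZl_R ?expR_ge0//.
  case: hH => _ [_ [_ [_ [_ [_ lap]]]]].
  have := lap 1 n.+1%:R ler01 (ler0n _ _); rewrite unlock => ->.
  by rewrite -EFinM lee_fin -expRM_natl mulrN.
suff : fine (P (~` unbounded_path)) <= 0.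
  move=> H0; apply/eqP; rewrite eq_le measure_ge0 andbT.
  by rewrite -(fineK (fin_num_measure P _ mUC)) lee_fin.
have cvg0 : expR t * expR (- phi) ^+ n.+1 @[n --> \oo] --> (0 : R).
  rewrite -[X in _ --> X](mulr0 (expR t)); apply: cvgM; first exact: cvg_cst.
  rewrite (cvg_shiftS (fun n => expR (- phi) ^+ n)).
  by apply: cvg_expr; rewrite ger0_norm ?expR_ge0// -expR0 ltr_expR oppr_lt0.
by apply: (ler_cvg_to (cvg_cst _) cvg0); exact: nearW.
Qed.

Lemma prob_inverse_ge x :
  fine (P [set w | H x w <= t]) <= fine (P [set w | x <= L w]).
Proof.
have mL := measurable_inverse_subordinator.
have mU := measurable_unbounded_path.
have mHx : measurable [set w | H x w <= t] by exact: measurable_le_set.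
have mLx : measurable [set w | x <= L w] by exact: measurable_ge_set.
apply: fine_le; do ?exact: fin_num_measure.
have -> : P [set w | H x w <= t] = P ([set w | H x w <= t] `&` unbounded_path).
  rewrite (measureDI P mHx mU) [X in (X + _)%E](_ : _ = 0%E) ?add0e//.
  apply/eqP; rewrite eq_le measure_ge0 andbT -prob_unbounded_path.
  apply: le_measure; rewrite ?inE; first exact: measurableD.
    exact: measurableC.
  by move=> w [].
apply: le_measure; rewrite ?inE//; first exact: measurableI.
by move=> w [Hx Uw]; exact: le_inverse_subordinator.
Qed.

Lemma prob_inverse_le x y : 0 < y -> y < x ->
  fine (P [set w | x <= L w]) <= fine (P [set w | H y w <= t]).
Proof.
move=> y0 yx; apply: fine_prob_le.
- by apply: measurable_ge_set; exact: measurable_inverse_subordinator.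
- exact: measurable_le_set.
- by move=> w /=; exact: inverse_subordinator_le.
Qed.

End inverse.

(** * Tail of the exponential variable *)

Section exponential_variable.
Context {R : realType} {d : measure_display} {Omega : measurableType d}.
Variables (P : probability Omega R) (mu : R) (T : Omega -> R).
Hypothesis mT : measurable_fun setT T.
Hypothesis expT : forall A : set R, measurable A ->
  P (T @^-1` A) = exponential_prob mu A.

Lemma prob_exponential_lt0 : P [set w | T w < 0] = 0%E.
Proof.
have -> : [set w | T w < 0] = T @^-1` `]-oo, 0[.
  by apply/seteqP; split => w /=; rewrite in_itv.
rewrite expT// /exponential_prob integral0_eq// => y /=.
by rewrite in_itv/= => y0; rewrite lt0_exponential_pdf.
Qed.

Lemma prob_exponential_gt x : 0 < x ->
  fine (P [set w | x < T w]) = expR (- (mu * x)).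
Proof.
move=> x0.
have mneg : measurable [set w | T w < 0].
  rewrite (_ : mkset _ = ~` [set w | 0 <= T w]); last first.
    by apply/seteqP; split => w /=; rewrite ltNge => /negP.
  exact/measurableC/measurable_ge_set.
have mitv : measurable (T @^-1` `[0, x]) by rewrite -[_ @^-1` _]setTI; exact: mT.
(* The tail is computed by complement, from the mass of [[0, x]] and the null set of negative
   values. *)
have -> : [set w | x < T w] = ~` ([set w | T w < 0] `|` T @^-1` `[0, x]).
  apply/seteqP; split => w /=; rewrite in_itv/=.
    move=> xT [|/andP[_]]; last by rewrite leNgt xT.
    by rewrite ltNge (ltW (lt_trans x0 xT)).
  move=> nT; rewrite ltNge; apply/negP => Tx; apply: nT.
  by have [T0|T0] := ltP (T w) 0; [left|right; rewrite Tx].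
rewrite probability_setC; last exact: measurableU.
have -> : P ([set w | T w < 0] `|` T @^-1` `[0, x]) =
    (P [set w | T w < 0%R]%R + P (T @^-1` `[0%R, x]))%E.
  apply: measureU => //; apply/seteqP; split => // w /= [T0].
  by rewrite in_itv/= leNgt T0.
rewrite prob_exponential_lt0 add0e expT// exponential_prob_itv0c//.
by rewrite /= opprB addrCA subrr addr0 mulNr.
Qed.

End exponential_variable.

Theorem theorem4p3 (R : realType) (mu : R) (mu_gt0 : 0 < mu)
  (d1 : measure_display) (Omega1 : measurableType d1) (P1 : probability Omega1 R)
  (B : R -> Omega1 -> R) (hB : std_brownian_motion P1 B)
  (d2 : measure_display) (Omega2 : measurableType d2) (P2 : probability Omega2 R)
  (H : R -> Omega2 -> R)
  (hH : subordinator P2 H (relativistic_exponent ((mu / 2) ^+ 2)))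
  (T : Omega2 -> R) (hTm : measurable_fun setT T)
  (hTexp : forall A : set R, measurable A ->
     P2 (T @^-1` A) = exponential_prob mu A)
  (hTind : indep_of_process P2 T (inverse_subordinator H)) :
  forall t : R, 0 < t ->
  forall A : set R, measurable A ->
    P1 [set w | A (running_max (fun s w' => - (mu * s) + Num.sqrt 2 * B s w') t w)]
    = P2 [set w | A (Num.min (inverse_subordinator H t w) (T w))].
Proof.
move=> t t0 A mA.
pose M := running_max (drifted mu B) t.
pose L := inverse_subordinator H t.
pose K w := Num.min (L w) (T w).
have mM : measurable_fun setT M by exact: (measurable_running_max P1).
have eta0 : 0 <= (mu / 2) ^+ 2 by exact: sqr_ge0.
have mL : measurable_fun setT L.
  exact: (measurable_inverse_subordinator P2 _ _ hH).
have mK : measurable_fun setT K by exact: measurable_minr.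
apply: (eq_distribution_ge P1 P2 M K mM mK _ A mA) => x.
have mMx y : measurable [set w | y <= M w] by exact: measurable_ge_set.
have mKx y : measurable [set w | y <= K w] by exact: measurable_ge_set.
(* For [x <= 0] both probabilities are 1: the maximum and [L] are nonnegative, and [T] is so almost
   surely. *)
have [x0|x0] := leP x 0.
  transitivity (1%E : \bar R).
    rewrite (_ : mkset _ = setT) ?probability_setT//.
    apply/seteqP; split => // w _ /=; apply: (le_trans x0).
    exact: (running_max_ge0 P1).
  apply/esym; rewrite -[mkset _]setCK probability_setC; last exact: measurableC.
  rewrite [X in (_ - X)%E](_ : _ = 0%E) ?sube0//.
  apply/eqP; rewrite eq_le measure_ge0 andbT -(prob_exponential_lt0 P2 mu T hTexp).
  apply: le_measure; rewrite ?inE; first exact: measurableC.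
    rewrite (_ : mkset _ = ~` [set w | 0 <= T w]); last first.
      by apply/seteqP; split => w /=; rewrite ltNge => /negP.
    exact/measurableC/measurable_ge_set.
  move=> w /= /negP; rewrite -ltNge gt_min => /orP[Lx|Tx]; last exact: lt_le_trans Tx x0.
  have := inverse_subordinator_ge0 H t w.
  by rewrite leNgt (lt_le_trans Lx x0).
(* Independence from the process is used at the single time [t], with two rays as test sets. *)
have indLT z y : fine (P2 [set w | z < T w /\ y <= L w]) =
    fine (P2 [set w | z < T w]) * fine (P2 [set w | y <= L w]).
  have := hTind 1%N (fun=> t) `]z, +oo[%classic (fun=> `[y, +oo[%classic)
    (fun=> ltW t0) (measurable_itv _) (fun=> measurable_itv _).
  rewrite (_ : mkset _ = [set w | z < T w /\ y <= L w]); last first.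
    apply/seteqP; split => w /=; rewrite in_itv/= andbT.
      by move=> [zT /(_ ord0)]; rewrite in_itv/= andbT.
    by move=> [zT yL]; split => // i; rewrite in_itv/= andbT.
  rewrite (_ : T @^-1` _ = [set w | z < T w]); last first.
    by apply/seteqP; split => w /=; rewrite in_itv/= andbT.
  rewrite (_ : [set w | forall i, _] = [set w | y <= L w]); last first.
    apply/seteqP; split => w /=.
      by move=> /(_ ord0); rewrite in_itv/= andbT.
    by move=> yL i; rewrite in_itv/= andbT.
  move=> ->; rewrite fineM// fin_num_measure//.
  - exact: measurable_gt_set.
  - exact: measurable_ge_set.
have mTL z y : measurable [set w | z < T w /\ y <= L w].
  by apply: measurableI; [exact: measurable_gt_set|exact: measurable_ge_set].
have Kge y : 0 < y -> fine (P1 [set w | y < M w]) <= fine (P2 [set w | y <= K w]).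
  move=> y0.
  apply: (le_trans (prob_max_gt_le P1 P2 mu B H mu_gt0 hB hH y t y0 t0)).
  rewrite -(prob_exponential_gt P2 mu T hTm hTexp y y0).
  apply: (@le_trans _ _ (fine (P2 [set w | y < T w /\ y <= L w]))).
    rewrite indLT ler_wpM2l ?fine_ge0//.
    exact: (prob_inverse_ge P2 _ _ eta0 hH).
  by apply: fine_prob_le => // w [yT yL] /=; rewrite le_min yL ltW.
have Kle y z : 0 < z -> z < y ->
    fine (P2 [set w | y <= K w]) <= fine (P1 [set w | z <= M w]).
  move=> z0 zy.
  apply: le_trans (prob_max_ge_ge P1 P2 mu B H mu_gt0 hB hH z t z0 t0).
  rewrite -(prob_exponential_gt P2 mu T hTm hTexp z z0).
  apply: (@le_trans _ _ (fine (P2 [set w | z < T w /\ y <= L w]))).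
    apply: fine_prob_le => // w /=; rewrite le_min => /andP[yL yT].
    by split => //; exact: lt_le_trans yT.
  rewrite indLT ler_wpM2l ?fine_ge0//.
  exact: (prob_inverse_le P2 _ _ hH).
(* Left continuity in the level, obtained from [prob_le_right_lim] for [- f]; a window of length [x]
   keeps the levels [y] positive. *)
have leftlim d (Om : measurableType d) (P : probability Om R) (f : Om -> R) (c : R) :
    measurable_fun setT f ->
    (forall y, 0 < y -> y < x -> c <= fine (P [set w | y <= f w])) ->
    c <= fine (P [set w | x <= f w]).
  move=> mf Hc.
  have E y : [set w | y <= f w] = [set w | (\- f) w <= - y].
    by apply/seteqP; split => w /=; rewrite lerN2.
  rewrite E -[leRHS]mul1r.
  apply: (prob_le_right_lim P _ (measurable_funN mf) _ x) => // u /andP[xu ux].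
  rewrite mul1r -[u]opprK -E; apply: Hc; first by rewrite oppr_gt0 (lt_le_trans ux)// addNr.
  by rewrite ltrNl.
rewrite -[LHS]fineK ?fin_num_measure// -[RHS]fineK ?fin_num_measure//; congr (_%:E).
(* [Kge] and [Kle] compare the two tails at levels [y < x]; letting [y] increase to [x] gives both
   inequalities at [x]. *)
apply/eqP; rewrite eq_le; apply/andP; split.
  apply: leftlim => // y y0 yx; apply: le_trans (Kge _ y0).
  apply: fine_prob_le => //; first exact: measurable_gt_set.
  by move=> w /=; exact: lt_le_trans.
by apply: leftlim => // y y0 yx; exact: Kle.
Qed.
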